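(* Let $X,Y$ be compact subsets of $\mathbb{R}$, let $n\geq 1$ be an integer, and let $E$ and $F$ be $n$-dimensional normed spaces over $\mathbb{K}$. Let $T:AC(X,E)\rightarrow AC(Y,F)$ be a separating and bijective map. Then there exist a homeomorphism $h:Y\rightarrow X$ (from $Y$ onto $X$) and, for each $y\in Y$, a linear, bijective and continuous map $J_{y}:E\rightarrow F$, such that $$Tf(y)=J_{y}(f(h(y)))$$ for every $f\in AC(X,E)$ and $y\in Y$. Also, $T$ is continuous (with respect to the norms $\|\cdot\|_{AC}$) and biseparating.
   Context: $\mathbb{K}$ denotes $\mathbb{R}$ or $\mathbb{C}$ (the same field for $E$ and $F$). For a compact set $X\subset\mathbb{R}$ and a Banach space $E$ over $\mathbb{K}$, a function $f:X\to E$ is absolutely continuous if for every $\varepsilon>0$ there is $\delta>0$ such that $\sum_{i=1}^{m}\|f(b_i)-f(a_i)\|<\varepsilon$ for each finite family of non-overlapping open intervals $\{(a_i,b_i)\}_{i=1}^{m}$ whose endpoints belong to $X$ with $\sum_{i=1}^{m}(b_i-a_i)<\delta$. $AC(X,E)$ is the space of all such functions, with norm $\|f\|_{AC}:=\|f\|_\infty+V(f;X)$, where $\|\cdot\|_\infty$ is the supremum norm and $V(f;X):=\sup\sum_{i=1}^{m}\|f(x_i)-f(x_{i-1})\|$, the supremum being over all finite families $x_0<x_1<\dots<x_m$ of points of $X$. The cozero set of $f$ is $c(f):=\{x: f(x)\neq 0\}$. A map $T:AC(X,E)\to AC(Y,F)$ is separating if it is linear and $c(Tf)\cap c(Tg)=\emptyset$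 whenever $f,g\in AC(X,E)$ satisfy $c(f)\cap c(g)=\emptyset$. $T$ is biseparating if it is bijective and both $T$ and $T^{-1}$ are separating. *)

(* Defs.v *)
From HB Require Import structures.
From mathcomp Require Import all_boot all_order all_algebra.
From mathcomp Require Import complex.
From mathcomp Require Import all_classical all_reals all_analysis.

Set Implicit Arguments.
Unset Strict Implicit.
Unset Printing Implicit Defensive.
Import Order.TTheory GRing.Theory Num.Theory.
Import numFieldNormedType.Exports.
Local Open Scope classical_set_scope.
Local Open Scope ring_scope.

Variant scalars := RealScalars | ComplexScalars.

Definition scalar_field (R : realType) (s : scalars) : numFieldType :=
  match s with
  | RealScalars => R
  | ComplexScalars => R[i]
  end.

Definition scalar_re (R : realType) (s : scalars) : scalar_field R s -> R :=
  match s with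
  | RealScalars => fun x : R => x
  | ComplexScalars => fun z : R[i] => complex.Re z
  end.

(* The norm of a normedModType K takes its values in K; when K = R[i] these   *)
(* values are nonnegative reals, so taking the real part loses nothing.       *)
Definition rnorm (R : realType) (s : scalars)
    (E : normedModType (scalar_field R s)) (v : E) : R :=
  scalar_re `|v|.

Definition abs_continuous (R : realType) (s : scalars) (X : set R)
    (E : normedModType (scalar_field R s)) (f : X -> E) : Prop :=
  forall eps : R, 0 < eps ->
  exists2 delta : R, 0 < delta &
    forall (m : nat) (a b : 'I_m -> X),
      (forall i, \val (a i) < \val (b i)) ->
      trivIset setT (fun i => `]\val (a i), \val (b i)[%classic) ->
      \sum_(i < m) (\val (b i) - \val (a i)) < delta ->
      \sum_(i < m) rnorm (f (b i) - f (a i)) < eps.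

Definition AC_pred (R : realType) (s : scalars) (X : set R)
    (E : normedModType (scalar_field R s)) : {pred X -> E} :=
  mem [set f : X -> E | abs_continuous f].
Arguments AC_pred {R s} X E.

Record AC_space (R : realType) (s : scalars) (X : set R)
    (E : normedModType (scalar_field R s)) := MkAC_space {
  AC_fun :> X -> E ;
  _ : AC_fun \in AC_pred X E
}.
Arguments AC_space {R s} X E.

HB.instance Definition _ (R : realType) (s : scalars) (X : set R)
    (E : normedModType (scalar_field R s)) :=
  [isSub for @AC_fun R s X E].
HB.instance Definition _ (R : realType) (s : scalars) (X : set R)
    (E : normedModType (scalar_field R s)) :=
  [Choice of AC_space X E by <:].

Lemma scalar_re_ge0 (R : realType) (s : scalars) (x : scalar_field R s) :
  0 <= x -> 0 <= scalar_re x.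
Proof. by case: s x => //= x; rewrite lecE => /andP[]. Qed.

Lemma rnormZ (R : realType) (s : scalars) (E : normedModType (scalar_field R s))
    (c : scalar_field R s) (v : E) : rnorm (c *: v) = scalar_re `|c| * rnorm v.
Proof.
rewrite /rnorm normrZ; case: s E c v => //= E c v.
by rewrite -[`|v|]RRe_real ?normr_real//= mulr0 subr0.
Qed.

Lemma rnormD (R : realType) (s : scalars) (E : normedModType (scalar_field R s))
    (u v : E) : rnorm (u + v) <= rnorm u + rnorm v.
Proof.
have := ler_normD u v; rewrite /rnorm; case: s E u v => //= E u v.
by case: `|u| => a b; case: `|v| => a' b'; rewrite lecE => /andP[].
Qed.

Lemma AC_submod_closed (R : realType) (s : scalars) (X : set R)
    (E : normedModType (scalar_field R s)) : submod_closed (AC_pred X E).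
Proof.
split=> [|c f g]; rewrite !inE /=.
  move=> eps eps0; exists 1 => // m a b _ _ _.
  rewrite big1 // => i _; rewrite subrr -(scale0r (0 : E)) rnormZ normr0.
  by case: s E => [|] /= E; rewrite mul0r.
move=> fAC gAC eps eps0; set k := scalar_re `|c|.
have k0 : 0 <= k by exact: scalar_re_ge0.
have k1 : 0 < k + 1 by rewrite ltr_wpDl.
have e2 : 0 < eps / 2 by rewrite divr_gt0.
have [df df0 fP] := fAC _ (divr_gt0 e2 k1).
have [dg dg0 gP] := gAC _ e2.
exists (Num.min df dg); first by rewrite lt_min df0.
move=> m a b ab tab; rewrite lt_min => /andP[].
move=> /(fP m a b ab tab) Sf /(gP m a b ab tab) Sg.
have kSf : (k + 1) * \sum_(i < m) rnorm (f (b i) - f (a i)) <= eps / 2.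
  by rewrite -ler_pdivlMl // mulrC ltW.
rewrite [ltRHS]splitr; apply: le_lt_trans (ler_ltD kSf Sg).
apply: (@le_trans _ _ (\sum_(i < m) (k * rnorm (f (b i) - f (a i)) +
    rnorm (g (b i) - g (a i))))).
  apply: ler_sum => i _; rewrite -rnormZ.
  have -> : (c *: f + g) (b i) - (c *: f + g) (a i) =
      c *: (f (b i) - f (a i)) + (g (b i) - g (a i)).
    by rewrite scalerBr addrACA -opprD.
  exact: rnormD.
rewrite big_split /= lerD2r -mulr_sumr ler_wpM2r ?lerDl//.
by apply: sumr_ge0 => i _; exact: scalar_re_ge0.
Qed.

HB.instance Definition _ (R : realType) (s : scalars) (X : set R)
    (E : normedModType (scalar_field R s)) :=
  GRing.isSubmodClosed.Build (scalar_field R s) (X -> E) (AC_pred X E)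
    (@AC_submod_closed R s X E).
HB.instance Definition _ (R : realType) (s : scalars) (X : set R)
    (E : normedModType (scalar_field R s)) :=
  [SubChoice_isSubLmodule of AC_space X E by <:].

(* The point 0 makes the supremum over an empty X equal to 0 instead of -oo.  *)
Definition sup_norm (R : realType) (s : scalars) (X : set R)
    (E : normedModType (scalar_field R s)) (f : X -> E) : \bar R :=
  ereal_sup (0%E |` range (fun x => (rnorm (f x))%:E)).

Definition variation (R : realType) (s : scalars) (X : set R)
    (E : normedModType (scalar_field R s)) (f : X -> E) : \bar R :=
  ereal_sup [set (\sum_(p <- zip xs (behead xs)) rnorm (f p.2 - f p.1))%:E
            | xs in [set xs : seq X | sorted <%R (map val xs)]].

Definition AC_norm (R : realType) (s : scalars) (X : set R)
    (E : normedModType (scalar_field R s)) (f : AC_space X E) : \bar R :=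
  (sup_norm f + variation f)%E.

Definition AC_norm_continuous (R : realType) (s : scalars) (X Y : set R)
    (E F : normedModType (scalar_field R s))
    (T : AC_space X E -> AC_space Y F) : Prop :=
  forall (f : AC_space X E) (eps : R), 0 < eps ->
  exists2 delta : R, 0 < delta &
    forall g : AC_space X E, (AC_norm (g - f)%R < delta%:E)%E ->
      (AC_norm (T g - T f)%R < eps%:E)%E.

Definition cozero (R : realType) (s : scalars) (X : set R)
    (E : normedModType (scalar_field R s)) (f : AC_space X E) : set X :=
  [set x | f x != 0].

Definition separating (R : realType) (s : scalars) (X Y : set R)
    (E F : normedModType (scalar_field R s))
    (T : AC_space X E -> AC_space Y F) : Prop :=
  linear T /\
  forall f g : AC_space X E,
    cozero f `&` cozero g = set0 -> cozero (T f) `&` cozero (T g) = set0.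

Definition biseparating (R : realType) (s : scalars) (X Y : set R)
    (E F : normedModType (scalar_field R s))
    (T : AC_space X E -> AC_space Y F) : Prop :=
  exists S : AC_space Y F -> AC_space X E,
    [/\ cancel T S, cancel S T, separating T & separating S].

Definition homeomorphism (U V : topologicalType) (h : U -> V) : Prop :=
  exists k : V -> U, [/\ cancel h k, cancel k h, continuous h & continuous k].

(* Main.v *)
(* For each y the functional f |-> T f y has a single support point h y in X:
   T f y = 0 as soon as f vanishes near h y. Call y a discontinuity if
   T f y <> 0 for some f with f (h y) = 0. Infinitely many discontinuities over
   disjoint intervals of X are impossible, because small humps at their support
   points glue to an absolutely continuous f with T f unbounded. One
   discontinuity y0 would produce them: localizing a witness at h y0 makes it so
   small that all y near y0 are discontinuities; if T u is supported near y0 then,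
   as surjective linear maps E -> F are injective, all support points in the open
   set u <> 0 come from discontinuities; they are dense there and not isolated.
   Hence T f y = J y (f (h y)), T^-1 is separating, and the same result for T^-1
   inverts h and bounds the maps (J y)^-1.
   For the continuity of T, h need not be monotone; but nondecreasing Lipschitz
   w : R -> [0, 1] have uniformly bounded Var (w o h), and the variation of f
   along finitely many points is dominated by the increments of such a w. *)

Require Import Defs.
From HB Require Import structures.
From mathcomp Require Import all_boot all_order all_algebra.
From mathcomp Require Import complex.
From mathcomp Require Import lra.
From mathcomp Require Import all_classical all_reals all_analysis.
Set Implicit Arguments.
Unset Strict Implicit.
Unset Printing Implicit Defensive.
Import Order.TTheory GRing.Theory Num.Theory.
Import numFieldNormedType.Exports.
Local Open Scope classical_set_scope.
Local Open Scope ring_scope.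

(** * Real scalars inside the field, and the norm with real values *)

Definition scalar_of (R : realType) (s : scalars) : R -> scalar_field R s :=
  match s with
  | RealScalars => fun x : R => x
  | ComplexScalars => fun x : R => (x%:C)%C
  end.
Arguments scalar_of {R} s x.

Lemma scalar_of_norm (R : realType) (s : scalars) (x : R) :
  scalar_re `|scalar_of s x| = `|x|.
Proof.
by case: s => //=; rewrite expr0n /= addr0 sqrtr_sqr.
Qed.

Lemma scalar_ofB (R : realType) (s : scalars) (x y : R) :
  scalar_of s (x - y) = scalar_of s x - scalar_of s y.
Proof. by case: s => //=; rewrite rmorphB. Qed.

Lemma scalar_of0 (R : realType) (s : scalars) : scalar_of s (0 : R) = 0.
Proof. by case: s. Qed.

Lemma scalar_of1 (R : realType) (s : scalars) : scalar_of s (1 : R) = 1.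
Proof. by case: s. Qed.

(** In the order of [R[i]], [0 <= c] forces the imaginary part to vanish. *)
Lemma scalar_reK (R : realType) (s : scalars) (c : scalar_field R s) :
  0 <= c -> scalar_of s (scalar_re c) = c.
Proof.
case: s c => //= c c0; apply/eqP.
by rewrite eq_complex /= eqxx (ger0_Im c0) eqxx.
Qed.

Lemma scalar_of_lt (R : realType) (s : scalars) (x y : R) :
  (scalar_of s x < scalar_of s y) = (x < y).
Proof. by case: s => //=; rewrite ltcR. Qed.

Lemma rnorm_ge0 (R : realType) (s : scalars)
    (E : normedModType (scalar_field R s)) (v : E) : 0 <= rnorm v.
Proof. exact: scalar_re_ge0. Qed.

Lemma rnormE (R : realType) (s : scalars)
    (E : normedModType (scalar_field R s)) (v : E) : `|v| = scalar_of s (rnorm v).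
Proof. by rewrite scalar_reK. Qed.

Lemma rnorm0 (R : realType) (s : scalars)
    (E : normedModType (scalar_field R s)) : rnorm (0 : E) = 0.
Proof. by rewrite /rnorm normr0; case: s E. Qed.

Lemma rnorm_eq0 (R : realType) (s : scalars)
    (E : normedModType (scalar_field R s)) (v : E) : (rnorm v == 0) = (v == 0).
Proof.
apply/eqP/eqP => [v0|->]; last exact: rnorm0.
by apply/normr0_eq0; rewrite rnormE v0 scalar_of0.
Qed.

Lemma rnorm_gt0 (R : realType) (s : scalars)
    (E : normedModType (scalar_field R s)) (v : E) : (0 < rnorm v) = (v != 0).
Proof. by rewrite lt_def rnorm_ge0 rnorm_eq0 andbT. Qed.

Lemma rnormN (R : realType) (s : scalars)
    (E : normedModType (scalar_field R s)) (v : E) : rnorm (- v) = rnorm v.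
Proof. by rewrite /rnorm normrN. Qed.

Lemma rdistrC (R : realType) (s : scalars)
    (E : normedModType (scalar_field R s)) (u v : E) :
  rnorm (u - v) = rnorm (v - u).
Proof. by rewrite -rnormN opprB. Qed.

Lemma rdistrD (R : realType) (s : scalars)
    (E : normedModType (scalar_field R s)) (w u v : E) :
  rnorm (u - v) <= rnorm (u - w) + rnorm (w - v).
Proof. by apply: le_trans (rnormD _ _); rewrite addrA subrK. Qed.

Lemma rnorm_le (R : realType) (s : scalars)
    (E : normedModType (scalar_field R s)) (u v : E) :
  rnorm u <= rnorm v + rnorm (u - v).
Proof. by apply: le_trans (rnormD _ _); rewrite addrC subrK. Qed.

Lemma rnorm_sum (R : realType) (s : scalars)
    (E : normedModType (scalar_field R s)) (I : Type) (r : seq I)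
    (P : pred I) (F : I -> E) :
  rnorm (\sum_(i <- r | P i) F i) <= \sum_(i <- r | P i) rnorm (F i).
Proof.
elim/big_ind2: _ => [|u x v y ux vy|//]; first by rewrite rnorm0.
exact: le_trans (rnormD _ _) (lerD ux vy).
Qed.

Lemma rnorm_scale (R : realType) (s : scalars)
    (E : normedModType (scalar_field R s)) (x : R) (v : E) :
  rnorm (scalar_of s x *: v) = `|x| * rnorm v.
Proof. by rewrite rnormZ scalar_of_norm. Qed.

(* Unlike [\val], this projection is not unfolded by simplification. *)
Definition crd (R : realType) (X : set R) (x : X) : R := \val x.
Arguments crd : simpl never.

Lemma crd_inj (R : realType) (X : set R) : injective (@crd R X).
Proof. exact: val_inj. Qed.

Lemma crd_ex (R : realType) (X : set R) (t : R) : X t -> exists x : X, crd x = t.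
Proof. by move=> Xt; exists (SigSub (mem_set Xt)). Qed.

Lemma crdP (R : realType) (X : set R) (x : X) : X (crd x).
Proof. exact: set_mem (valP x). Qed.

(** * Families of non-overlapping intervals *)

Definition disjoint_intervals (R : realType) (X : set R) m (a b : 'I_m -> X) :=
  (forall i, crd (a i) < crd (b i)) /\
  (forall i j, i != j -> crd (b i) <= crd (b j) -> crd (b i) <= crd (a j)).

(** The order form suits induction on the rightmost interval. If two intervals violated it, the
    midpoint between the larger left end and the smaller right end would lie in both. *)
Lemma disjoint_intervalsP (R : realType) (X : set R) m (a b : 'I_m -> X) :
  (forall i, crd (a i) < crd (b i)) ->
  trivIset setT (fun i => `]crd (a i), crd (b i)[%classic) <->
  disjoint_intervals a b.
Proof.
move=> ab; split=> [/trivIsetP tab|[_ dab]].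
  split=> // i j ij bij; rewrite leNgt; apply/negP => abij.
  have := tab i j Logic.I Logic.I ij; apply/eqP/set0P.
  exists ((Num.max (crd (a i)) (crd (a j)) + crd (b i)) / 2).
  have := ab i.
  by case: (ltP (crd (a i)) (crd (a j))) => aij; split;
    rewrite /= in_itv /=; apply/andP; split; lra.
apply/trivIsetP => i j _ _ ij; apply/eqP/negPn/negP => /set0P[t []].
rewrite /= !in_itv /= => /andP[it ti] /andP[jt tj].
have [bij|/ltW bji] := leP (crd (b i)) (crd (b j)).
  have := dab i j ij bij; lra.
rewrite eq_sym in ij; have := dab j i ij bji; lra.
Qed.

(** Induction on the number of intervals: once the one with the greatest right end is removed, the
    others lie left of its left end, and the bounds telescope. *)
Lemma sum_increments_le (R : realType) (X : set R) m (a b : 'I_m -> X)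
    (w : R -> R) (P : {set 'I_m}) (l u : R) :
  disjoint_intervals a b -> {homo w : x y / x <= y} -> l <= u ->
  (forall i, i \in P -> l <= crd (a i) /\ crd (b i) <= u) ->
  \sum_(i in P) (w (crd (b i)) - w (crd (a i))) <= w u - w l.
Proof.
move=> [_ dab] wh.
have [k] := ubnP #|P|; elim: k P u => // k IH P u /ltnSE cP lu inP.
have [->|[i0 i0P]] := set_0Vmem P.
  by rewrite big_set0 subr_ge0 wh.
pose i := [arg max_(i > i0 in P) crd (b i)]%O.
have [iP imax] : i \in P /\ forall j, j \in P -> crd (b j) <= crd (b i).
  by rewrite /i; case: arg_maxP => // j jP jm; split.
rewrite (big_setD1 i) //=.
have [la bu] := inP _ iP.
have : \sum_(j in P :\ i) (w (crd (b j)) - w (crd (a j))) <= w (crd (a i)) - w l.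
  apply: IH => //; first by move: cP; rewrite (cardsD1 i P) iP add1n.
  move=> j; rewrite !inE => /andP[ji jP].
  split; first by have [] := inP _ jP.
  exact: dab ji (imax _ jP).
have := wh _ _ bu; lra.
Qed.

Lemma sum_increments_bounded (R : realType) (X : set R) m (a b : 'I_m -> X)
    (w : R -> R) (B : R) :
  disjoint_intervals a b -> {homo w : x y / x <= y} ->
  (forall x, 0 <= w x <= B) ->
  \sum_(i < m) (w (crd (b i)) - w (crd (a i))) <= B.
Proof.
move=> dab wh wB.
case: m => [|m] in a b dab *; first by rewrite big_ord0; have := wB 0; lra.
pose l := crd (a [arg min_(i < ord0) crd (a i)]%O).
pose u := crd (b [arg max_(i > ord0) crd (b i)]%O).
have la i : l <= crd (a i).
  by rewrite /l; case: arg_minP => [|j _ jm]; [by []|exact: jm].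
have bu i : crd (b i) <= u.
  by rewrite /u; case: arg_maxP => [|j _ jm]; [by []|exact: jm].
have lu : l <= u by have := la ord0; have := bu ord0; have [/(_ ord0)] := dab; lra.
have /(_ [set: 'I_m.+1])%SET := sum_increments_le dab wh lu _.
rewrite (eq_bigl xpredT) => [H|i]; last by rewrite inE.
have := H (fun i _ => conj (la i) (bu i)).
have := wB l; have := wB u; lra.
Qed.

Lemma abs_continuousE (R : realType) (s : scalars) (X : set R)
    (E : normedModType (scalar_field R s)) (f : X -> E) :
  abs_continuous f <-> forall eps : R, 0 < eps ->
    exists2 delta : R, 0 < delta & forall m (a b : 'I_m -> X),
      disjoint_intervals a b -> \sum_(i < m) (crd (b i) - crd (a i)) < delta ->
      \sum_(i < m) rnorm (f (b i) - f (a i)) < eps.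
Proof.
split=> fAC eps /fAC[d d0 fd]; exists d => // m a b.
  by move=> [ab dab]; apply: fd => //; apply/(disjoint_intervalsP ab).
by move=> ab /(disjoint_intervalsP ab); exact: fd.
Qed.

Lemma disjoint_intervals_sub (R : realType) (X : set R) m (a b : 'I_m -> X)
    k (g : 'I_k -> 'I_m) : injective g -> disjoint_intervals a b ->
  disjoint_intervals (a \o g) (b \o g).
Proof.
move=> gI [ab dab]; split=> [i|i j ij]; first exact: ab.
by apply: dab; rewrite (inj_eq gI).
Qed.

(** Selecting a subfamily matters when only the intervals near a given point have small total
    length. *)
Lemma abs_continuous_sub (R : realType) (s : scalars) (X : set R)
    (E : normedModType (scalar_field R s)) (f : X -> E) (eps : R) :
  abs_continuous f -> 0 < eps ->
  exists2 delta : R, 0 < delta & forall m (a b : 'I_m -> X) (P : {set 'I_m}),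
      disjoint_intervals a b -> \sum_(i in P) (crd (b i) - crd (a i)) < delta ->
      \sum_(i in P) rnorm (f (b i) - f (a i)) < eps.
Proof.
move=> /abs_continuousE fAC /fAC[d d0 fd]; exists d => // m a b P dab.
rewrite big_enum_val => Pd; rewrite big_enum_val.
apply: (fd _ (a \o enum_val) (b \o enum_val)) Pd.
exact: disjoint_intervals_sub (@enum_val_inj _ _) dab.
Qed.

(** * Piecewise linear cutoff functions *)

Definition ramp (R : realType) (a b t : R) : R :=
  Num.max 0 (Num.min 1 ((t - a) / (b - a))).

Section Ramp.
Context {R : realType} (a b : R).
Hypothesis ab : a < b.

Lemma ramp_bounds t : 0 <= ramp a b t <= 1.
Proof. by rewrite le_max lexx /= ge_max ler01 ge_min lexx. Qed.

Lemma ramp_homo : {homo ramp a b : x y / x <= y}.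
Proof.
move=> x y xy; rewrite /ramp.
have : (x - a) / (b - a) <= (y - a) / (b - a).
  by rewrite ler_wpM2r ?lerB// invr_ge0 subr_ge0 ltW.
move: (_ / _) (_ / _) => u v uv.
by rewrite !maxEle !minEle; do !case: ifP => //; lra.
Qed.

Lemma ramp0 t : t <= a -> ramp a b t = 0.
Proof.
move=> ta; apply/max_idPl; rewrite ge_min; apply/orP; right.
by rewrite mulr_le0_ge0 ?subr_le0// invr_ge0 subr_ge0 ltW.
Qed.

Lemma ramp1 t : b <= t -> ramp a b t = 1.
Proof.
move=> bt; rewrite /ramp; have -> : Num.min 1 ((t - a) / (b - a)) = 1.
  by apply/min_idPl; rewrite ler_pdivlMr ?subr_gt0// mul1r lerB.
exact/max_idPr.
Qed.

(** Clamping to [[0, 1]] does not increase distances, so the slope of the affine function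
    survives. *)
Lemma ramp_lipschitz x y :
  `|ramp a b x - ramp a b y| <= (b - a)^-1 * `|x - y|.
Proof.
have b0 : 0 <= (b - a)^-1 by rewrite invr_ge0 subr_ge0 ltW.
have -> : (b - a)^-1 * `|x - y| = `|(x - a) / (b - a) - (y - a) / (b - a)|.
  rewrite -mulrBl normrM (ger0_norm b0) mulrC; congr (`|_| * _); lra.
rewrite /ramp; move: (_ / _) (_ / _) => u v.
have := ler_norm (u - v); have := ler_norm (v - u); rewrite (distrC v u).
rewrite !maxEle !minEle => uv vu.
by do !case: ifP => //; do ?[move/negbT; rewrite -ltNge]; move=> *;
  rewrite ler_norml; apply/andP; split; lra.
Qed.
End Ramp.

Section Bump.
Context {R : realType}.

(** A trapezoid, written as a difference of two nondecreasing functions so that its increments are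
    bounded by theirs. *)
Definition bump (c r t : R) : R :=
  ramp (c - r) (c - r / 2) t - ramp (c + r / 2) (c + r) t.

Lemma bump_bounds c r t : 0 < r -> 0 <= bump c r t <= 1.
Proof.
move=> r0; rewrite /bump.
have := @ramp_bounds R (c - r) (c - r / 2) t.
have := @ramp_bounds R (c + r / 2) (c + r) t => /andP[p1 p2] /andP[q1 q2].
apply/andP; split; last lra.
have [tc|ct] := leP t (c + r / 2).
  rewrite [X in _ <= _ - X]ramp0; lra.
rewrite [X in _ <= X - _]ramp1; lra.
Qed.

Lemma bump1 c r t : 0 < r -> `|t - c| <= r / 2 -> bump c r t = 1.
Proof.
move=> r0; rewrite ler_distl => /andP[h1 h2].
by rewrite /bump ramp1 ?ramp0 ?subr0//; lra.
Qed.

Lemma bump0 c r t : 0 < r -> r <= `|t - c| -> bump c r t = 0.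
Proof.
move=> r0; rewrite /bump leNgt ltr_distl negb_and -!leNgt.
move=> /orP[|] h.
  by rewrite !ramp0 ?subr0//; lra.
by rewrite !ramp1 ?subrr//; lra.
Qed.

(** Each ramp has slope [2 / r], and the triangle inequality adds the two slopes. *)
Lemma bump_lipschitz c r x y : 0 < r ->
  `|bump c r x - bump c r y| <= 4 * r^-1 * `|x - y|.
Proof.
move=> r0; rewrite /bump.
have h1 : c - r < c - r / 2 by lra.
have h2 : c + r / 2 < c + r by lra.
have := ramp_lipschitz h1 x y; have := ramp_lipschitz h2 x y.
have -> : c + r - (c + r / 2) = r / 2 by lra.
have -> : c - r / 2 - (c - r) = r / 2 by lra.
have e (p q u v : R) : u - p - (v - q) = (u - v) - (p - q) by lra.
rewrite invf_div e => pq uv; apply: le_trans (ler_normB _ _) _.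
have -> : 4 * r^-1 * `|x - y| = 2 / r * `|x - y| + 2 / r * `|x - y| by lra.
lra.
Qed.
End Bump.

(** * Basic properties of absolutely continuous functions *)

Section AbsContinuous.
Context {R : realType} {s : scalars} {X : set R}.
Local Notation K := (scalar_field R s).
Implicit Types E F : normedModType K.

Lemma abs_continuous0 E : abs_continuous (fun _ : X => 0 : E).
Proof.
move=> eps eps0; exists 1 => // m a b _ _ _.
by rewrite big1 // => i _; rewrite subrr rnorm0.
Qed.

(** One comparison covers Lipschitz functions, with [A = 0], and products with Lipschitz cutoffs. *)
Lemma abs_continuous_dominated E F (f : X -> E) (g : X -> F) (A L : R) :
  abs_continuous f -> 0 <= A -> 0 <= L ->
  (forall x y,
    rnorm (g x - g y) <= A * rnorm (f x - f y) + L * `|crd x - crd y|) ->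
  abs_continuous g.
Proof.
move=> /abs_continuousE fAC A0 L0 fg; apply/abs_continuousE => eps eps0.
(* Dividing by [A + 1] and [L + 1] avoids a separate case for zero constants. *)
have A1 : 0 < A + 1 by lra.
have L1 : 0 < L + 1 by lra.
have e2 : 0 < eps / 2 by lra.
have [d d0 fd] := fAC _ (divr_gt0 e2 A1).
exists (Num.min d (eps / 2 / (L + 1))); first by rewrite lt_min d0 divr_gt0.
move=> m a b dab; rewrite lt_min => /andP[/(fd _ _ _ dab)].
rewrite !ltr_pdivlMr// => fS lS.
have : \sum_(i < m) rnorm (g (b i) - g (a i)) <=
    A * (\sum_(i < m) rnorm (f (b i) - f (a i))) +
    L * (\sum_(i < m) (crd (b i) - crd (a i))).
  rewrite !mulr_sumr -big_split /=; apply: ler_sum => i _.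
  by apply: le_trans (fg _ _) _; rewrite gtr0_norm // subr_gt0 dab.1.
have : 0 <= \sum_(i < m) rnorm (f (b i) - f (a i)).
  by apply: sumr_ge0 => i _; exact: rnorm_ge0.
have : 0 <= \sum_(i < m) (crd (b i) - crd (a i)).
  by apply: sumr_ge0 => i _; rewrite subr_ge0 ltW ?dab.1.
nra.
Qed.

Lemma abs_continuous_lipschitz E (g : X -> E) (L : R) : 0 <= L ->
  (forall x y, rnorm (g x - g y) <= L * `|crd x - crd y|) -> abs_continuous g.
Proof.
move=> L0 gL; apply: (abs_continuous_dominated (abs_continuous0 E) (lexx 0) L0).
by move=> x y; rewrite mul0r add0r.
Qed.

Lemma abs_continuous_cst E (v : E) : abs_continuous (fun _ : X => v).
Proof.
apply: (@abs_continuous_lipschitz _ _ 0) => // x y.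
by rewrite subrr rnorm0 mul0r.
Qed.

Lemma AC_space_of E (f : X -> E) :
  abs_continuous f -> exists g : AC_space X E, g = f :> (X -> E).
Proof.
move=> fAC; have fP : f \in AC_pred X E by rewrite !inE.
by exists (MkAC_space fP).
Qed.

Lemma AC_funP E (f : AC_space X E) : abs_continuous f.
Proof. by case: f => f /=; rewrite !inE. Qed.

Lemma AC_ext E (f g : AC_space X E) : (forall x, f x = g x) -> f = g.
Proof. by move=> fg; apply/val_inj/funext. Qed.

Lemma AC_addE E (f g : AC_space X E) x : (f + g) x = f x + g x.
Proof. by []. Qed.

Lemma AC_subE E (f g : AC_space X E) x : (f - g) x = f x - g x.
Proof. by []. Qed.

Lemma AC_zeroE E x : (0 : AC_space X E) x = 0.
Proof. by []. Qed.

Lemma AC_scaleE E c (f : AC_space X E) x : (c *: f) x = c *: f x.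
Proof. by []. Qed.

Lemma AC_sumE E (I : Type) (r : seq I) (P : pred I) (F : I -> AC_space X E) x :
  (\sum_(i <- r | P i) F i) x = \sum_(i <- r | P i) F i x.
Proof. by elim/big_rec2: _ => // i u v _ <-. Qed.

Lemma abs_continuous_uniform E (f : X -> E) (eps : R) :
  abs_continuous f -> 0 < eps ->
  exists2 d : R, 0 < d &
    forall x y, `|crd x - crd y| < d -> rnorm (f x - f y) < eps.
Proof.
move=> /abs_continuousE fAC eps0; have [d d0 fd] := fAC _ eps0.
exists d => // x y; wlog xy : x y / crd x < crd y => [H xyd|xyd].
  have [/H|/H|/crd_inj ->] := ltgtP (crd x) (crd y); first exact.
    by rewrite rdistrC distrC; exact.
  by rewrite subrr rnorm0.
have := fd 1%N (fun _ => x) (fun _ => y); rewrite !big_ord1 rdistrC; apply.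
  by split=> // i j; rewrite !ord1.
by rewrite distrC gtr0_norm ?subr_gt0 in xyd.
Qed.

Lemma compact_bounds : compact X ->
  exists2 B : R, 0 < B & forall x : X, - B < crd x < B.
Proof.
move=> /compact_bounded[M [_ XM]]; exists (`|M| + 2) => [|x].
  by have := normr_ge0 M; lra.
rewrite -ltr_norml.
have /XM/(_ _ (crdP x)) /= : M < `|M| + 1 by have := ler_norm M; lra.
lra.
Qed.

(** The range of coordinates is cut into finitely many cells of length [d]. A cell that meets [X] in
    a point [y] adds at most 1 to [rnorm (f y)]; an empty cell changes nothing. *)
Lemma abs_continuous_bounded E (f : X -> E) : compact X -> abs_continuous f ->
  exists2 M : R, 0 < M & forall x, rnorm (f x) <= M.
Proof.
move=> /compact_bounds[B B0 XB] fAC.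
have [d d0 fd] := abs_continuous_uniform fAC ltr01.
have grid N : exists2 M : R, 0 < M &
    forall x, crd x < - B + N%:R * d -> rnorm (f x) <= M.
  elim: N => [|N [M M0 fM]]; first by exists 1 => // x; have := XB x; lra.
  have [[y [y1 y2]]|ny] := pselect (exists y : X,
      - B + N%:R * d <= crd y /\ crd y < - B + N.+1%:R * d).
    exists (M + rnorm (f y) + 1); first by have := rnorm_ge0 (f y); lra.
    move=> x; rewrite -natr1 mulrDl mul1r => xN.
    have [/fM|xN'] := ltP (crd x) (- B + N%:R * d).
      by have := rnorm_ge0 (f y); lra.
    have : rnorm (f x - f y) < 1.
      apply: fd; rewrite -natr1 mulrDl mul1r in y2.
      by rewrite ltr_norml; apply/andP; split; lra.
    have := rnorm_le (f x) (f y); lra.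
  exists M => // x xN; apply: fM; rewrite ltNge; apply/negP => xN'.
  by apply: ny; exists x.
have [M M0 fM] := grid (Num.truncn (2 * B / d)).+1.
exists M => // x; apply: fM; have := truncnS_gt (2 * B / d).
rewrite ltr_pdivrMr//; have := XB x; lra.
Qed.

(** The product rule gives a comparison with constants [B] and [M * L], where [M] bounds [f] by
    compactness. *)
Lemma abs_continuous_mul E (f : X -> E) (phi : R -> R) (B L : R) :
  compact X -> abs_continuous f -> 0 <= L -> (forall t, `|phi t| <= B) ->
  (forall t u, `|phi t - phi u| <= L * `|t - u|) ->
  abs_continuous (fun x => scalar_of s (phi (crd x)) *: f x).
Proof.
move=> cX fAC L0 phiB phiL; have [M M0 fM] := abs_continuous_bounded cX fAC.
have B0 : 0 <= B by apply: le_trans (phiB 0).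
apply: (abs_continuous_dominated fAC B0 (mulr_ge0 (ltW M0) L0)) => x y.
have -> : scalar_of s (phi (crd x)) *: f x - scalar_of s (phi (crd y)) *: f y =
  scalar_of s (phi (crd x)) *: (f x - f y) +
  scalar_of s (phi (crd x) - phi (crd y)) *: f y.
  by rewrite scalerBr scalar_ofB scalerBl addrA subrK.
apply: le_trans (rnormD _ _) _; rewrite !rnorm_scale.
have := phiB (crd x); have := phiL (crd x) (crd y).
have := fM y; have := rnorm_ge0 (f y); have := rnorm_ge0 (f x - f y).
have := normr_ge0 (phi (crd x) - phi (crd y)).
move=> h1 h2 h3 h4 h5 h6; apply: lerD; first exact: ler_wpM2r.
by rewrite -mulrA mulrC; apply: ler_pM.
Qed.
End AbsContinuous.

Lemma linear_ex (K : nzRingType) (U V : lmodType K) (f : U -> V) :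
  linear f -> exists g : {linear U -> V}, g = f :> (U -> V).
Proof.
move=> fL; pose g : {linear U -> V} := HB.pack f (GRing.isLinear.Build K U V _ f fL).
by exists g.
Qed.

(** * Localizing a function at a zero, and gluing humps *)

Section Gluing.
Context {R : realType} {s : scalars} {X : set R}.
Local Notation K := (scalar_field R s).
Implicit Types E : normedModType K.

Lemma bump_increment (c r x y : R) : 0 < r -> x <= y ->
  `|bump c r y - bump c r x| <=
    (ramp (c - r) (c - r / 2) y - ramp (c - r) (c - r / 2) x) +
    (ramp (c + r / 2) (c + r) y - ramp (c + r / 2) (c + r) x).
Proof.
move=> r0 xy; rewrite /bump.
have h1 : c - r < c - r / 2 by lra.
have h2 : c + r / 2 < c + r by lra.
have := ramp_homo h1 xy; have := ramp_homo h2 xy => i1 i2.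
by rewrite ler_norml; apply/andP; split; lra.
Qed.

Lemma AC_cutoff E (f : AC_space X E) (c r : R) : compact X -> 0 < r ->
  exists g : AC_space X E, forall x, g x = scalar_of s (bump c r (crd x)) *: f x.
Proof.
move=> cX r0; have L0 : 0 <= 4 * r^-1 by rewrite mulr_ge0 // invr_ge0 ltW.
have [|t u|g gE] := AC_space_of (@abs_continuous_mul _ s _ _ _ (bump c r) 1 _
    cX (AC_funP f) L0 _ _).
- by move=> t; have /andP[b0 b1] := bump_bounds c t r0; rewrite ger0_norm.
- exact: bump_lipschitz.
- by exists g => x; rewrite gE.
Qed.

(** Multiply [f] by a narrow bump at its zero [x0]. By the product rule the variation is at most
    that of [f] on a short window, below [eps / 4], plus [eps / 4] times the variation of the bump,
    which is at most 2. *)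
Lemma AC_localize E (f : AC_space X E) (x0 : X) (r eps : R) :
  compact X -> f x0 = 0 -> 0 < r -> 0 < eps ->
  exists (g : AC_space X E) (eta : R), [/\ 0 < eta,
    forall x, `|crd x - crd x0| < eta -> g x = f x,
    forall x, r <= `|crd x - crd x0| -> g x = 0,
    forall x, rnorm (g x) <= eps &
    forall m (a b : 'I_m -> X), disjoint_intervals a b ->
      \sum_(i < m) rnorm (g (b i) - g (a i)) <= eps].
Proof.
move=> cX fx0 r0 eps0; have e0 : 0 < eps / 4 by lra.
have [d1 d10 fd1] := abs_continuous_sub (AC_funP f) e0.
have [d2 d20 fd2] := abs_continuous_uniform (AC_funP f) e0.
(* The window has length [2 * rho < d1], which makes the variation of [f] in it small; [rho <= d2]
   makes the values of [f] small. *)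
pose rho := Num.min r (Num.min (d1 / 3) d2).
have rho0 : 0 < rho by rewrite !lt_min r0 d20 divr_gt0.
have rhor : rho <= r by rewrite ge_min lexx.
have rhod1 : rho <= d1 / 3 by rewrite !ge_min lexx orbT.
have rhod2 : rho <= d2 by rewrite !ge_min lexx !orbT.
have [g gE] := AC_cutoff f (crd x0) cX rho0.
have fsmall x : `|crd x - crd x0| < rho -> rnorm (f x) <= eps / 4.
  by move=> xr; apply/ltW; rewrite -[f x]subr0 -fx0; apply: fd2; lra.
set phi := bump (crd x0) rho in gE.
have phi01 t : `|phi t| <= 1.
  by have /andP[b0 b1] := bump_bounds (crd x0) t rho0; rewrite ger0_norm.
have phi0 (x : X) : rho <= `|crd x - crd x0| -> phi (crd x) = 0 by exact: bump0.
have gout x : rho <= `|crd x - crd x0| -> g x = 0.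
  by move=> xr; rewrite gE phi0// scalar_of0 scale0r.
exists g, (rho / 2); split.
- by lra.
- by move=> x xr; rewrite gE /phi bump1 ?scalar_of1 ?scale1r//; exact: ltW.
- by move=> x rx; apply: gout; lra.
- move=> x; have [/gout ->|/fsmall xr] := leP rho (`|crd x - crd x0|).
    by rewrite rnorm0; lra.
  rewrite gE rnorm_scale; have := phi01 (crd x); have := rnorm_ge0 (f x); nra.
move=> m a b dab.
(* Only intervals with both ends in the window see the variation of [f]. If an end lies outside, [g]
   and the bump vanish there, and the increment of the bump suffices. *)
pose P := [set i | (`|crd (a i) - crd x0| < rho) &&
                   (`|crd (b i) - crd x0| < rho)]%SET.
have h1 : crd x0 - rho < crd x0 - rho / 2 by lra.
have h2 : crd x0 + rho / 2 < crd x0 + rho by lra.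
pose w1 := ramp (crd x0 - rho) (crd x0 - rho / 2).
pose w2 := ramp (crd x0 + rho / 2) (crd x0 + rho).
have bound i : rnorm (g (b i) - g (a i)) <=
    (if i \in P then rnorm (f (b i) - f (a i)) else 0) +
    eps / 4 * (w1 (crd (b i)) - w1 (crd (a i)) +
               (w2 (crd (b i)) - w2 (crd (a i)))).
  have /(bump_increment (crd x0) rho0) := ltW (dab.1 i).
  rewrite -/w1 -/w2 -/phi; set W := (X in _ <= X) => dphi.
  have W0 : 0 <= W by apply: le_trans dphi.
  have eW : eps / 4 * `|phi (crd (b i)) - phi (crd (a i))| <= eps / 4 * W.
    by apply: ler_wpM2l => //; exact: ltW.
  rewrite inE.
  have [ai|ai] := ltP (`|crd (a i) - crd x0|) rho;
  have [bi|bi] := ltP (`|crd (b i) - crd x0|) rho => /=.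
  - rewrite !gE.
    have -> : scalar_of s (phi (crd (b i))) *: f (b i) -
        scalar_of s (phi (crd (a i))) *: f (a i) =
      scalar_of s (phi (crd (b i))) *: (f (b i) - f (a i)) +
      scalar_of s (phi (crd (b i)) - phi (crd (a i))) *: f (a i).
      by rewrite scalerBr scalar_ofB scalerBl addrA subrK.
    apply: le_trans (rnormD _ _) _; rewrite !rnorm_scale; apply: lerD.
      by rewrite ler_piMl ?rnorm_ge0.
    by apply: le_trans eW; rewrite mulrC ler_wpM2r// fsmall.
  - rewrite (gout (b i))// sub0r rnormN gE rnorm_scale add0r.
    apply: le_trans eW; rewrite (phi0 (b i))// sub0r normrN mulrC.
    by rewrite ler_wpM2r// fsmall.
  - rewrite (gout (a i))// subr0 gE rnorm_scale add0r.
    apply: le_trans eW; rewrite (phi0 (a i))// subr0 mulrC.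
    by rewrite ler_wpM2r// fsmall.
  - rewrite (gout (a i))// (gout (b i))// subr0 rnorm0 add0r.
    by rewrite mulr_ge0// ltW.
apply: le_trans (ler_sum _ (fun i _ => bound i)) _.
rewrite big_split /= -mulr_sumr big_split /= -big_mkcond /=.
have : \sum_(i in P) rnorm (f (b i) - f (a i)) < eps / 4.
  apply: fd1 => //.
  have := @sum_increments_le _ _ _ a b id P (crd x0 - rho) (crd x0 + rho) dab.
  move=> /(_ (fun _ _ h => h)) H; apply: le_lt_trans (H _ _) _; [lra| |lra].
  move=> i; rewrite inE !ltr_distl => /andP[/andP[? _] /andP[_ ?]].
  by split; exact: ltW.
have := sum_increments_bounded dab (ramp_homo h1) (ramp_bounds _ _).
have := sum_increments_bounded dab (ramp_homo h2) (ramp_bounds _ _).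
by rewrite -/w1 -/w2; nra.
Qed.

(** Closedness under convergence in variation; the values of [f - g] themselves need not be
    small. *)
Lemma abs_continuous_limit E (f : X -> E) :
  (forall eps : R, 0 < eps -> exists2 g : X -> E, abs_continuous g &
    forall m (a b : 'I_m -> X), disjoint_intervals a b ->
    \sum_(i < m) rnorm ((f (b i) - g (b i)) - (f (a i) - g (a i))) <= eps) ->
  abs_continuous f.
Proof.
move=> fg; apply/abs_continuousE => eps eps0.
have [e2 e3] : 0 < eps / 2 /\ 0 < eps / 3 by split; lra.
have [g /abs_continuousE gAC gf] := fg _ e3.
have [d d0 gd] := gAC _ e2; exists d => // m a b dab /(gd _ _ _ dab) gS.
have fS := gf _ _ _ dab.
have : \sum_(i < m) rnorm (f (b i) - f (a i)) <=
  \sum_(i < m) rnorm ((f (b i) - g (b i)) - (f (a i) - g (a i))) +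
  \sum_(i < m) rnorm (g (b i) - g (a i)).
  rewrite -big_split /=; apply: ler_sum => i _.
  apply: le_trans (rnormD _ _).
  by rewrite opprB -addrA (addrC (g (a i) - f (a i))) !subrKA.
lra.
Qed.

Lemma half_expr_small (eps : R) : 0 < eps -> exists N, (2^-1 : R) ^+ N < eps.
Proof.
move=> e0; have := truncnS_gt eps^-1; set N := _.+1 => Ne; exists N.
rewrite exprVn invf_plt ?posrE ?exprn_gt0//.
by apply: (lt_trans Ne); rewrite -natrX ltr_nat ltn_expl.
Qed.

Lemma half_expr_sum (m n : nat) : (m <= n)%N ->
  \sum_(m <= k < n) (2^-1 : R) ^+ k <= 2 * 2^-1 ^+ m - 2 * 2^-1 ^+ n.
Proof.
elim: n => [|n IH]; first by rewrite leqn0 => /eqP ->; rewrite big_geq// subrr.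
rewrite leq_eqVlt => /predU1P[->|/[dup] mn /IH]; first by rewrite big_geq// subrr.
rewrite big_nat_recr//= [in 2^-1 ^+ n.+1]exprS; lra.
Qed.

(** The humps have disjoint supports, so their sum is locally a single term at each point. The
    partial sums are absolutely continuous and the remainders have geometrically small variation. *)
Lemma AC_glue E (g : nat -> AC_space X E) (t : nat -> R) :
  (forall k, t k < t k.+1) ->
  (forall k x, g k x != 0 -> t k < crd x < t k.+1) ->
  (forall k m (a b : 'I_m -> X), disjoint_intervals a b ->
    \sum_(i < m) rnorm (g k (b i) - g k (a i)) <= 2^-1 ^+ k) ->
  exists f : AC_space X E, forall k x, t k < crd x < t k.+1 -> f x = g k x.
Proof.
move=> tS gt gV.
have tm : {homo t : i j / (i <= j)%N >-> i <= j}.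
  by apply/nondecreasing_seqP => k; exact: ltW.
have g0 k j x : t k < crd x < t k.+1 -> j != k -> g j x = 0.
  move=> /andP[kx xk] jk; apply/eqP/negPn/negP => /gt/andP[jx xj].
  case/orP: (leq_total j k); rewrite leq_eqVlt ?(negbTE jk)// 1?eq_sym ?(negbTE jk)//=.
    by move=> /tm; lra.
  by move=> /tm; lra.
(* At each point at most one term is nonzero, so the series is a finite sum whose length depends on
   [x]. *)
have /choice[N NP] x : exists N, forall k, (N <= k)%N -> g k x = 0.
  have [[k /gt xk]|ng] := pselect (exists k, g k x != 0).
    by exists k.+1 => j kj; apply: g0 xk _; rewrite gtn_eqF.
  by exists 0%N => k _; apply/eqP/negPn/negP => gk; apply: ng; exists k.
pose f x := \sum_(0 <= k < N x) g k x.
have fE x n : (N x <= n)%N -> f x = \sum_(0 <= k < n) g k x.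
  move=> Nn; rewrite (big_cat_nat (leq0n _) Nn)//= [X in _ + X]big_nat.
  rewrite [X in _ + X]big1 ?addr0//.
  by move=> k /andP[Nk _]; exact: NP.
have [|F FE] := @AC_space_of _ s _ _ f.
  apply: abs_continuous_limit => eps eps0.
  have e2 : 0 < eps / 2 by lra.
  have [n nE] := half_expr_small e2.
  exists (\sum_(0 <= k < n) g k : AC_space X E); first exact: AC_funP.
  move=> m a b dab.
  (* A common length for all the endpoints of the family turns the remainder into a finite sum. *)
  pose M := maxn n (\max_(i < m) maxn (N (a i)) (N (b i))).
  have nM : (n <= M)%N by rewrite leq_maxl.
  have aM i : (N (a i) <= M)%N.
    rewrite leq_max; apply/orP; right.
    by apply: leq_trans (leq_bigmax i); rewrite leq_maxl.
  have bM i : (N (b i) <= M)%N.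
    rewrite leq_max; apply/orP; right.
    by apply: leq_trans (leq_bigmax i); rewrite leq_maxr.
  apply: (@le_trans _ _ (\sum_(i < m) \sum_(n <= k < M) rnorm (g k (b i) - g k (a i)))).
    apply: ler_sum => i _; rewrite (fE _ _ (aM i)) (fE _ _ (bM i)) !AC_sumE.
    have e (p q : E) : p + q - p = q by rewrite addrAC subrr add0r.
    rewrite !(big_cat_nat (leq0n _) nM)//= !e -sumrB; exact: rnorm_sum.
  rewrite exchange_big /=.
  apply: (@le_trans _ _ (\sum_(n <= k < M) 2^-1 ^+ k)).
    by apply: ler_sum => k _; exact: gV.
  apply: (le_trans (half_expr_sum nM)).
  have : 0 <= (2^-1 : R) ^+ M by rewrite exprn_ge0.
  lra.
exists F => k x xk; rewrite FE (fE x (maxn (N x) k.+1)) ?leq_maxl//.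
rewrite big_mkord (bigD1 (Ordinal (leq_maxr (N x) k.+1)))//= big1 ?addr0//.
by move=> j jk; exact: g0 xk _.
Qed.
End Gluing.

(** * Finite-dimensional normed spaces *)

Section FiniteDimension.
Context {R : realType}.

Lemma row_entry_le_norm m (u : 'rV[R]_m) i : `|u 0 i| <= `|u|.
Proof.
by rewrite [leRHS]/Num.Def.normr /= mx_normrE; apply/bigmax_geP; right; exists (0, i).
Qed.

(** [N] is continuous, hence has a minimum on the compact unit sphere. It is positive, and [C] is
    its inverse. *)
Lemma norm_equiv_rV (m : nat) (N : 'rV[R]_m -> R) :
  (forall u v, N (u + v) <= N u + N v) ->
  (forall a u, N (a *: u) = `|a| * N u) ->
  (forall u, N u = 0 -> u = 0) ->
  exists2 C : R, 0 < C & forall u, `|u| <= C * N u.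
Proof.
move=> ND NZ N0.
have NN u : N (- u) = N u by rewrite -scaleN1r NZ normrN1 mul1r.
have N00 : N 0 = 0 by rewrite -(scale0r 0) NZ normr0 mul0r.
have Nge0 u : 0 <= N u.
  have := ND u (- u); rewrite subrr N00 NN; lra.
(* An empty unit sphere means that 0 is the only vector, and then any constant works. *)
have [[u0 nu0]|nA] := pselect (exists u : 'rV[R]_m, `|u| = 1); last first.
  exists 1 => // u; have [->|u0] := eqVneq u 0; first by rewrite normr0 N00 mulr0.
  exfalso; apply: nA; exists (`|u|^-1 *: u).
  by rewrite normrZ normfV normr_id mulVf// normr_eq0.
pose B := \sum_(i < m) N (delta_mx 0 i).
have NB u : N u <= B * `|u|.
  rewrite {1}(row_sum_delta u) mulr_suml.
  apply: (@le_trans _ _ (\sum_(i < m) N (u 0 i *: delta_mx 0 i))).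
    by elim/big_ind2: _ => [|p x q y px qy|//]; rewrite ?N00//;
       apply: le_trans (ND _ _) (lerD px qy).
  apply: ler_sum => i _; rewrite NZ mulrC ler_wpM2l//.
  exact: row_entry_le_norm.
have B0 : 0 <= B by apply: sumr_ge0.
have NC : continuous N.
  move=> u; apply/(@cvgrPdist_lt _ _ _ _ (nbhs_filter u)) => eps eps0.
  apply: (proj2 (@nbhs_normP R 'rV[R]_m u _)).
  exists (eps / (B + 1)) => [|v /= uv].
    by rewrite /= divr_gt0//; lra.
  move: uv; rewrite ltr_pdivlMr; last lra.
  have := NB (u - v); have := normr_ge0 (u - v).
  have h1 := ND (u - v) v; have h2 := ND (v - u) u.
  rewrite subrK in h1; rewrite subrK -opprB NN in h2; move=> ? ? ?.
  by rewrite ltr_norml; apply/andP; split; lra.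
have cA : compact [set u : 'rV[R]_m | `|u| = 1].
  apply: bounded_closed_compact.
    by exists 1; split; [exact: num_real | move=> x x1 u /= ->; exact: ltW].
  apply: (@closed_comp _ _ (fun u : 'rV[R]_m => `|u|) [set 1]).
    by move=> u _; exact: norm_continuous.
  exact: closed_eq.
have [||c] := @EVT_min_rV R m N _ _ cA; first by exists u0.
  by apply: continuous_subspaceT.
rewrite inE /= => c1 cmin.
have Nc : 0 < N c.
  rewrite lt_def Nge0 andbT; apply/eqP => /N0 cz.
  by move: c1; rewrite cz normr0; lra.
exists (N c)^-1 => [|u]; first by rewrite invr_gt0.
have [->|uz] := eqVneq u 0; first by rewrite normr0 N00 mulr0.
have un : 0 < `|u| by rewrite normr_gt0.
rewrite mulrC ler_pdivlMr// mulrC.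
have /cmin : (`|u|^-1 *: u) \in [set u : 'rV[R]_m | `|u| = 1].
  by rewrite inE /= normrZ normfV normr_id mulVf// gt_eqF.
by rewrite NZ normfV normr_id => h; rewrite -ler_pdivlMr// mulrC.
Qed.

(** The norm is transported to row vectors and compared with the maximum norm. Complex coordinates
    are first replaced by twice as many real ones. *)
Lemma coordinates_bounded (s : scalars) (E : normedModType (scalar_field R s))
    n (phi : {linear E -> 'rV[scalar_field R s]_n}) : bijective phi ->
  exists2 C : R, 0 < C &
    forall v i, scalar_re `|phi v 0 i| <= C * rnorm v.
Proof.
move=> [psi phiK psiK].
have psiD u v : psi (u + v) = psi u + psi v.
  by apply: (can_inj phiK); rewrite linearD !psiK.
have psiZ a u : psi (a *: u) = a *: psi u.
  by apply: (can_inj phiK); rewrite linearZ !psiK.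
have psi0 u : rnorm (psi u) = 0 -> u = 0.
  by move/eqP; rewrite rnorm_eq0 => /eqP h; rewrite -(psiK u) h linear0.
case: s E phi psi phiK psiK psiD psiZ psi0 => E phi psi phiK psiK psiD psiZ psi0.
  have [|||C C0 hC] := @norm_equiv_rV n (fun u => rnorm (psi u)).
  - by move=> u v; rewrite psiD; exact: rnormD.
  - by move=> a u; rewrite psiZ (@rnorm_scale R RealScalars).
  - exact: psi0.
  exists C => // v i; apply: le_trans (row_entry_le_norm _ _) _.
  by have := hC (phi v); rewrite phiK.
pose cx (u : 'rV[R]_(n + n)) : 'rV[R[i]]_n :=
  \row_j (u 0 (lshift n j) +i* u 0 (rshift n j))%C.
have cxD u v : cx (u + v) = cx u + cx v by apply/rowP => j; rewrite !mxE.
have cxZ a u : cx (a *: u) = (a%:C)%C *: cx u.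
  by apply/rowP => j; rewrite !mxE; apply/eqP; rewrite eq_complex /= !mul0r subr0 addr0 !eqxx.
have [|||C C0 hC] := @norm_equiv_rV (n + n) (fun u => rnorm (psi (cx u))).
- by move=> u v; rewrite cxD psiD; exact: rnormD.
- by move=> a u; rewrite cxZ psiZ (@rnorm_scale R ComplexScalars).
- move=> u /psi0 /rowP cu; apply/rowP => k; rewrite mxE.
  by case: (split_ordP k) => j ->; have := cu j; rewrite !mxE => -[].
(* The modulus is at most the sum of the absolute values of the real and imaginary parts, each
   bounded with [C]. *)
exists (C + C) => [|v i]; first lra.
pose u : 'rV[R]_(n + n) :=
  row_mx (\row_j complex.Re (phi v 0 j)) (\row_j complex.Im (phi v 0 j)).
have cu : cx u = phi v.
  by apply/rowP => j; rewrite mxE row_mxEl row_mxEr !mxE; case: (phi v 0 j).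
have := hC u; rewrite cu phiK => Cv.
have r1 := row_entry_le_norm u (lshift n i).
have r2 := row_entry_le_norm u (rshift n i).
rewrite row_mxEl row_mxEr !mxE in r1 r2.
have : scalar_re (s := ComplexScalars) `|phi v 0 i| <=
   `|complex.Re (phi v 0 i)| + `|complex.Im (phi v 0 i)|.
  case: (phi v 0 i) => x y /=.
  have xy0 : 0 <= `|x| + `|y| by rewrite addr_ge0.
  rewrite -[leRHS](ger0_norm xy0) -[leRHS]sqrtr_sqr ler_sqrt ?sqr_ge0//.
  have := mulr_ge0 (normr_ge0 x) (normr_ge0 y).
  rewrite sqrrD !real_normK ?num_real//; lra.
rewrite mulrDl; lra.
Qed.

Lemma finite_dim_basis (s : scalars) (E : normedModType (scalar_field R s)) n :
  Vector.axiom n E -> exists (e : 'I_n -> E) (c : E -> 'I_n -> scalar_field R s),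
    (forall v, v = \sum_(i < n) c v i *: e i) /\
    exists2 C : R, 0 < C & forall v i, scalar_re `|c v i| <= C * rnorm v.
Proof.
move=> [phi0 /linear_ex[phi <-] bphi].
have [C C0 hC] := coordinates_bounded bphi; case: bphi => psi phiK psiK.
exists (fun i => psi (delta_mx 0 i)), (fun v i => phi v 0 i); split.
  move=> v; apply: (can_inj phiK); rewrite linear_sum {1}(row_sum_delta (phi v)).
  by apply: eq_bigr => i _; rewrite linearZ psiK.
by exists C.
Qed.

(** In coordinates [J] is an [n] by [n] matrix. Surjectivity gives it rank [n], hence a trivial
    kernel. *)
Lemma surjective_injective (K : fieldType) (E F : lmodType K) n
    (J : {linear E -> F}) : Vector.axiom n E -> Vector.axiom n F ->
  (forall w, exists v, J v = w) -> forall v, J v = 0 -> v = 0.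
Proof.
move=> [p0 /linear_ex[p <-] [p' pK p'K]] [q0 /linear_ex[q <-] [q' qK q'K]] Js.
have p'L : linear p'.
  by move=> a u v; apply: (can_inj pK); rewrite linearP !p'K.
have [P PE] := linear_ex p'L.
pose G : {linear 'rV[K]_n -> 'rV[K]_n} := q \o J \o P.
pose M := lin1_mx G.
have MF : row_full M.
  apply/row_fullP; have /choice[f fP] i : exists v, J v = q' (delta_mx 0 i).
    exact: Js.
  exists (\matrix_i p (f i)); apply/row_matrixP => i.
  by rewrite row_mul rowK mul_rV_lin1 row1 /G /= PE pK fP q'K.
move=> v Jv; apply: (can_inj pK); rewrite linear0.
(* For a square matrix [row_full] and [row_free] are the same equation on the rank. *)
have : row_free M by exact: MF.
move=> Mf; apply: (row_free_inj Mf).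
by rewrite mul0mx mul_rV_lin1 /G /= PE pK Jv linear0.
Qed.
End FiniteDimension.

(** * Support points, and the absence of discontinuities *)

Section Separating.
Context {R : realType} {s : scalars} {X Y : set R}.
Context {E F : normedModType (scalar_field R s)}.
Hypotheses (cptX : compact X) (cptY : compact Y).

Lemma AC_cst_subproof (v : E) : (fun _ : X => v) \in AC_pred X E.
Proof. by rewrite inE; exact: abs_continuous_cst. Qed.

Definition AC_cst (v : E) : AC_space X E := MkAC_space (AC_cst_subproof v).

Lemma AC_cst_linear : linear AC_cst.
Proof. by move=> a u v; exact: AC_ext. Qed.

Lemma AC_ramp (f : AC_space X E) (a b : R) : a < b ->
  exists g : AC_space X E, forall x, g x = scalar_of s (ramp a b (crd x)) *: f x.
Proof.
move=> ab; have L0 : 0 <= (b - a)^-1 by rewrite invr_ge0 subr_ge0 ltW.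
have [|t u|g gE] := AC_space_of (@abs_continuous_mul _ s _ _ _ (ramp a b) 1 _
    cptX (AC_funP f) L0 _ _).
- by move=> t; have /andP[b0 b1] := ramp_bounds a b t; rewrite ger0_norm.
- exact: ramp_lipschitz.
- by exists g => x; rewrite gE.
Qed.

Variable T : {linear AC_space X E -> AC_space Y F}.
Hypothesis sepT : forall f g : AC_space X E, (forall x, f x = 0 \/ g x = 0) ->
  forall y, T f y = 0 \/ T g y = 0.

(** The point is the supremum of the thresholds [t] such that vanishing on the right of [t] forces
    [T f y = 0]. A function that vanishes near it is split by a ramp into a left part, killed by the
    definition of the supremum, and a right part, killed by separation. *)
Lemma support_point (y : Y) : (exists f, T f y != 0) ->
  exists x0 : X, forall (f : AC_space X E) (r : R), 0 < r ->
    (forall x, `|crd x - crd x0| < r -> f x = 0) -> T f y = 0.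
Proof.
move=> [f0 f0y]; have [B B0 XB] := compact_bounds cptX.
pose A := [set t : R | forall f : AC_space X E,
  (forall x, t <= crd x -> f x = 0) -> T f y = 0].
have AB : ubound A B.
  move=> t At; rewrite leNgt; apply/negP => Bt; move/eqP: f0y; apply.
  by apply: At => x tx; exfalso; have := XB x; lra.
have AN : A (- B).
  move=> f fz; have -> : f = 0 by apply: AC_ext => x; rewrite fz//; have /andP[/ltW] := XB x.
  by rewrite linear0.
have supA : has_sup A by split; [exists (- B)|exists B].
pose t := sup A.
have supp (f : AC_space X E) (r : R) : 0 < r ->
    (forall x, `|crd x - t| < r -> f x = 0) -> T f y = 0.
  move=> r0 fz.
  have tr : t - r / 2 < t + r / 2 by lra.
  have [f2 f2E] := AC_ramp f tr.
  have Tf1 : T (f - f2) y = 0.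
    have [e Ae te] := sup_adherent r0 supA; apply: Ae => x ex.
    rewrite AC_subE f2E; have [xt|tx] := ltP (crd x) (t + r / 2).
      have -> : f x = 0.
        apply: fz; rewrite ltr_distl -/t in te *.
        by apply/andP; split; lra.
      by rewrite scaler0 subr0.
    by rewrite ramp1// scalar_of1 scale1r subrr.
  have Tf2 : T f2 y = 0.
    (* As [t + r] exceeds the supremum, some [g] vanishing beyond it has [T g y != 0]; [f2] lives
       only beyond [t + r], so separation gives [T f2 y = 0]. *)
    have /existsNP[g /not_implyP[gz /eqP Tg]] : ~ A (t + r).
      by move=> /(sup_upper_bound supA); rewrite -/t; lra.
    have [|//|gy] := @sepT f2 g _ y; [move=> x|by move: Tg; rewrite gy eqxx].
    have [xt|/gz] := ltP (crd x) (t + r); last by right.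
    left; rewrite f2E; have [tx|xt'] := ltP (t - r) (crd x).
      by rewrite fz ?scaler0// ltr_distl; apply/andP; split; lra.
    by rewrite ramp0 ?scalar_of0 ?scale0r//; lra.
  by rewrite -(subrK f2 f) linearD AC_addE Tf1 Tf2 addr0.
have [/crd_ex[x0 x0t]|Xt] := pselect (X t).
  by exists x0 => f r r0; rewrite x0t; exact: supp.
(* If [t] were outside the closed set [X], every function would vanish near [t], including [f0]. *)
exfalso; have : nbhs t (~` X).
  apply: open_nbhs_nbhs; split=> //; apply: closed_openC.
  exact: compact_closed (@norm_hausdorff _ _) cptX.
move=> /nbhs_ballP[e /= e0 eX]; move/eqP: f0y; apply; apply: supp e0 _ => x xe.
by exfalso; apply: (eX (crd x)); [rewrite /ball /= distrC|exact: crdP].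
Qed.

Hypotheses (T_inj : forall f, T f = 0 -> f = 0)
  (T_surj : forall g, exists f, T f = g).
Variable n : nat.
Hypotheses (n_gt0 : (0 < n)%N) (dimE : Vector.axiom n E) (dimF : Vector.axiom n F).

(** The bound is uniform in [y] because, by linearity, only the [n] bounded functions
    [T (AC_cst (e i))] matter. *)
Lemma eval_cst_bounded : exists2 M : R, 0 < M &
  forall v y, rnorm (T (AC_cst v) y) <= M * rnorm v.
Proof.
have [e [c [vE [C C0 cC]]]] := finite_dim_basis dimE.
have /choice[M MP] i : exists M : R, 0 < M /\
    forall y, rnorm (T (AC_cst (e i)) y) <= M.
  have [M M0 MP] := abs_continuous_bounded cptY (AC_funP (T (AC_cst (e i)))).
  by exists M.
exists (C * (\sum_(i < n) M i + 1)) => [|v y].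
  by rewrite mulr_gt0// ltr_wpDl// sumr_ge0// => i _; exact: ltW (MP i).1.
have [cst cstE] := linear_ex AC_cst_linear.
have -> : T (AC_cst v) y = \sum_(i < n) c v i *: T (AC_cst (e i)) y.
  rewrite {1}(vE v) -cstE linear_sum linear_sum AC_sumE; apply: eq_bigr => i _.
  by rewrite !linearZ.
apply: le_trans (rnorm_sum _ _ _) _.
apply: (@le_trans _ _ (\sum_(i < n) C * rnorm v * M i)).
  apply: ler_sum => i _; rewrite rnormZ; apply: ler_pM => //.
  - exact: scalar_re_ge0.
  - exact: rnorm_ge0.
  - by have [_] := MP i.
rewrite -mulr_sumr mulrAC ler_wpM2r ?rnorm_ge0//.
by apply: ler_wpM2l; [exact: ltW|rewrite lerDl].
Qed.

Lemma nonzero_vector (G : normedModType (scalar_field R s)) :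
  Vector.axiom n G -> exists w : G, w != 0.
Proof.
move=> [p /linear_ex[q <-] [q' qK q'K]].
exists (q' (const_mx 1)); apply/negP => /eqP h.
have := q'K (const_mx 1); rewrite h linear0 => /rowP/(_ (Ordinal n_gt0)).
by rewrite !mxE => /esym/eqP; rewrite oner_eq0.
Qed.

Variable h : Y -> X.
Hypothesis hT : forall y (f : AC_space X E) (r : R), 0 < r ->
  (forall x, `|crd x - crd (h y)| < r -> f x = 0) -> T f y = 0.

(** Otherwise a bump at [x1] would vanish near every support point, so [T] would send it to 0
    against injectivity. *)
Lemma support_dense (x1 : X) (r : R) : 0 < r ->
  exists y, `|crd (h y) - crd x1| < r.
Proof.
move=> r0; have [v v0] := nonzero_vector dimE; apply/not_existsP => ny.
have r2 : 0 < r / 2 by lra.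
have [g gE] := AC_cutoff (AC_cst v) (crd x1) cptX r2.
have /T_inj gz : T g = 0.
  apply: AC_ext => y; apply: (hT r2) => x xy.
  have /negP := ny y; rewrite -leNgt => hy.
  rewrite gE bump0 ?scalar_of0 ?scale0r//.
  have := ler_distD (crd x) (crd (h y)) (crd x1).
  by rewrite (distrC (crd (h y)) (crd x)); lra.
have := gE x1; rewrite gz AC_zeroE bump1//; last by rewrite subrr normr0; lra.
by rewrite scalar_of1 scale1r => /esym/eqP; apply/negP.
Qed.

Definition discontinuity y := exists2 f : AC_space X E, f (h y) = 0 & T f y != 0.

Lemma continuity_point y : ~ discontinuity y ->
  forall f, T f y = T (AC_cst (f (h y))) y.
Proof.
move=> ny f; apply/eqP; rewrite -subr_eq0 -AC_subE -linearB.
apply/negPn/negP => fy; apply: ny; exists (f - AC_cst (f (h y))) => //.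
by rewrite AC_subE subrr.
Qed.

(** Scaling the witness fixes the norm of its image at [y]. Localizing then makes it small without
    altering that image, which depends only on values near [h y]. *)
Lemma discontinuity_scaled y (r eps C : R) :
  discontinuity y -> 0 < r -> 0 < eps -> 0 < C ->
  exists g : AC_space X E, [/\ rnorm (T g y) = C,
    forall x, r <= `|crd x - crd (h y)| -> g x = 0,
    forall x, rnorm (g x) <= eps &
    forall m (a b : 'I_m -> X), disjoint_intervals a b ->
      \sum_(i < m) rnorm (g (b i) - g (a i)) <= eps].
Proof.
move=> [f fy Tf] r0 eps0 C0.
pose f' := scalar_of s (C / rnorm (T f y)) *: f.
have f'y : f' (h y) = 0 by rewrite AC_scaleE fy scaler0.
have [g [eta [eta0 gf gout gsup gvar]]] := AC_localize cptX f'y r0 eps0.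
exists g; split=> //.
have -> : T g y = T f' y.
  apply/eqP; rewrite -subr_eq0 -AC_subE -linearB; apply/eqP; apply: (hT eta0) => x xy.
  by rewrite AC_subE gf// subrr.
rewrite linearZ AC_scaleE rnorm_scale ger0_norm ?divr_ge0 ?rnorm_ge0 ?(ltW C0)//.
by rewrite mulfVK// rnorm_eq0.
Qed.

(** At an isolated [h y], a function that is zero at [h y] is zero near it, so its image vanishes at
    [y]. *)
Lemma discontinuity_not_isolated y eta : discontinuity y -> 0 < eta ->
  exists2 x : X, crd x != crd (h y) & `|crd x - crd (h y)| < eta.
Proof.
move=> [f fy /eqP Tf] eta0; apply: contrapT => nx; apply: Tf; apply: (hT eta0) => x xy.
have [/crd_inj ->//|xhy] := eqVneq (crd x) (crd (h y)).
by exfalso; apply: nx; exists x.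
Qed.

(* Humps of variation 2^-k at h (y k) with |T g (y k)| = k+1 glue to a function
   whose image under T would be unbounded. *)
Lemma no_discontinuity_sequence (t : nat -> R) (y : nat -> Y) :
  (forall k, t k < crd (h (y k)) < t k.+1) -> ~ (forall k, discontinuity (y k)).
Proof.
move=> ty yd.
pose r k := Num.min (crd (h (y k)) - t k) (t k.+1 - crd (h (y k))).
have r0 k : 0 < r k by have := ty k; rewrite lt_min !subr_gt0.
have /choice[g gP] k : exists g : AC_space X E, [/\ rnorm (T g (y k)) = k.+1%:R,
    forall x, r k <= `|crd x - crd (h (y k))| -> g x = 0 &
    forall m (a b : 'I_m -> X), disjoint_intervals a b ->
      \sum_(i < m) rnorm (g (b i) - g (a i)) <= 2^-1 ^+ k].
  have e0 : 0 < (2^-1 : R) ^+ k by rewrite exprn_gt0.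
  have [g [g1 g2 _ g4]] := discontinuity_scaled (yd k) (r0 k) e0 (ltr0Sn R k).
  by exists g.
have rin k x : `|crd x - crd (h (y k))| < r k -> t k < crd x < t k.+1.
  by rewrite lt_min !ltr_norml => /andP[/andP[? ?] /andP[? ?]]; apply/andP; split; lra.
have [| | |f fg] := @AC_glue _ _ _ _ g t.
- by move=> k; have := ty k; lra.
- move=> k x; apply: contraNT => /negP nx; apply/eqP; have [_ gout _] := gP k.
  by apply: gout; rewrite leNgt; apply/negP => /rin.
- by move=> k; have [_ _] := gP k.
have [M M0 TM] := abs_continuous_bounded cptY (AC_funP (T f)).
have := truncnS_gt M; have := TM (y (Num.truncn M)).
set k := Num.truncn M.
have -> : T f (y k) = T (g k) (y k).
  apply/eqP; rewrite -subr_eq0 -AC_subE -linearB; apply/eqP; apply: (hT (r0 k)) => x xy.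
  by rewrite AC_subE (fg k) ?subrr//; exact: rin.
have [-> _ _] := gP k; lra.
Qed.

Lemma no_discontinuity y : ~ discontinuity y.
Proof.
have [M M0 cstM] := eval_cst_bounded.
(* At a continuity point, a function bounded by [1 / (2 * M)] has an image of norm at most 1/2,
   whereas [T f] has norm 1 at [y]. Uniform continuity then makes every point within [d] of [y] a
   discontinuity. *)
move=> y0d; have e0 : 0 < (2 * M)^-1 by rewrite invr_gt0; lra.
have [f [Tf1 _ fsup _]] := discontinuity_scaled y0d ltr01 e0 ltr01.
have [d d0 Tfd] := abs_continuous_uniform (AC_funP (T f)) (divr_gt0 ltr01 (ltr0Sn R 1)).
have near_y z : `|crd z - crd y| < d -> discontinuity z.
  move=> /Tfd zy; apply: contrapT => /continuity_point/(_ f) Tfz.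
  have := cstM (f (h z)) z; rewrite -Tfz.
  have := ler_wpM2l (ltW M0) (fsup (h z)).
  have -> : M * (2 * M)^-1 = 1 / 2 by rewrite invfM mulrCA divff ?mulr1 ?mul1r// gt_eqF.
  have := rnorm_le (T f y) (T f z); rewrite rdistrC; lra.
have [w w0] := nonzero_vector dimF.
have [w' w'E] : exists w' : AC_space Y F, forall z, w' z = w.
  by have [w' w'E] := AC_space_of (@abs_continuous_cst R s Y F w); exists w' => z; rewrite w'E.
have [g gE] := AC_cutoff w' (crd y) cptY d0.
have [u Tu] := T_surj g.
have [x1 ux1] : exists x1, u x1 != 0.
  apply: contrapT => /forallNP uz.
  have u0 : u = 0 by apply: AC_ext => x; apply/eqP/negPn/negP; exact: uz.
  have := gE y; rewrite -Tu u0 linear0 AC_zeroE bump1//; last by rewrite subrr normr0; lra.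
  by rewrite scalar_of1 scale1r w'E => /esym/eqP; apply/negP.
have [|r r0 ur] := abs_continuous_uniform (AC_funP u) (_ : 0 < rnorm (u x1)).
  by rewrite rnorm_gt0.
(* If [z] were a continuity point, it would be at least [d] away from [y], where [T u] vanishes. The
   weight at [z] is surjective, hence injective, so [u (h z) = 0]; but [u] has no zero within [r] of
   [x1]. *)
have near_x z : `|crd (h z) - crd x1| < r -> discontinuity z.
  move=> zx; apply: contrapT => nz; apply: (nz); apply: near_y.
  rewrite ltNge; apply/negP => dz.
  have Tuz : T (AC_cst (u (h z))) z = 0.
    by rewrite -(continuity_point nz) Tu gE bump0// scalar_of0 scale0r.
  have JL : linear (fun v => T (AC_cst v) z).
    by move=> a v v'; rewrite AC_cst_linear linearP AC_addE AC_scaleE.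
  have [J JE] := linear_ex JL.
  have Js w1 : exists v, J v = w1.
    have [w2 w2E] := AC_space_of (@abs_continuous_cst R s Y F w1).
    have [f1 Tf1'] := T_surj w2; exists (f1 (h z)).
    by rewrite JE -(continuity_point nz) Tf1' w2E.
  have uz : u (h z) = 0 by apply: (surjective_injective dimE dimF Js); rewrite JE.
  have := ur _ _ zx; rewrite uz sub0r rnormN ltxx//.
(* The invariant says that [X] still has a point between [t] and [crd x1 + r]. Each step moves [t]
   to the right past a new support point. *)
pose P (t : R) := crd x1 - r <= t /\ exists x : X, t < crd x < crd x1 + r.
have step t : P t -> exists mz : R * Y, P mz.1 /\ t < crd (h mz.2) < mz.1.
  move=> [tr [x /andP[tx xr]]].
  have dense t1 t2 (x2 : X) : t1 < crd x2 < t2 -> exists z, t1 < crd (h z) < t2.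
    move=> x2t; have [|z] := @support_dense x2 (Num.min (crd x2 - t1) (t2 - crd x2)).
      by rewrite lt_min !subr_gt0.
    rewrite lt_min !ltr_norml => /andP[/andP[? ?] /andP[? ?]].
    by exists z; apply/andP; split; lra.
  (* A support point is not isolated, which yields two points [p] and [q]. The next cut is their
     midpoint: density puts a support point on its left, and [q] preserves the invariant. *)
  have [p [q [tp pq qr]]] : exists p q : X,
      [/\ t < crd p, crd p < crd q & crd q < crd x1 + r].
    have [|z /andP[tz zr]] := dense t (crd x1 + r) x; first by rewrite tx.
    have zd : discontinuity z.
      by apply: near_x; rewrite ltr_distl; apply/andP; split; lra.
    have [|x2 x2z] := @discontinuity_not_isolated _
      (Num.min (crd (h z) - t) (crd x1 + r - crd (h z))) zd.
      by rewrite lt_min !subr_gt0 tz.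
    rewrite lt_min !ltr_norml => /andP[/andP[? ?] /andP[? ?]].
    move: x2z; rewrite neq_lt => /orP[x2z|zx2].
      by exists x2, (h z); split=> //; lra.
    by exists (h z), x2; split=> //; lra.
  have [|z /andP[tz zm]] := dense t ((crd p + crd q) / 2) p.
    by apply/andP; split; lra.
  exists ((crd p + crd q) / 2, z); split=> /=; last by rewrite tz.
  by split; [lra|exists q; apply/andP; split; lra].
have /choice[next nextP] (t : {t | P t}) :
    exists mz : {t | P t} * Y, sval t < crd (h mz.2) < sval mz.1.
  by case: t => t Pt; have [[m z] /= [Pm tz]] := step t Pt; exists (exist _ m Pm, z).
have P0 : P (crd x1 - r) by split=> //; exists x1; apply/andP; split; lra.
pose a k := iter k (fun t => (next t).1) (exist _ _ P0).
apply: (@no_discontinuity_sequence (fun k => sval (a k)) (fun k => (next (a k)).2)).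
  by move=> k; exact: nextP.
move=> k; apply: near_x; have := nextP (a k).
have [tr _] := svalP (a k); have [_ [x]] := svalP (next (a k)).1.
by rewrite ltr_distl => *; apply/andP; split; lra.
Qed.
End Separating.

(** * Sums along finite paths, and bounded variation *)

Section PathSums.
Context {R : realType} {X : set R}.
Implicit Types (d : X -> X -> R) (xs : seq X).

(** With [d x y = rnorm (f y - f x)] this is the sum occurring in [variation]; a general [d] allows
    sums of several increments. *)
Definition path_sum d xs := \sum_(p <- zip xs (behead xs)) d p.1 p.2.

Definition increasing xs := sorted <%R (map (@crd R X) xs).

Lemma path_sum_cons d x y xs :
  path_sum d [:: x, y & xs] = d x y + path_sum d (y :: xs).
Proof. by rewrite /path_sum /= big_cons. Qed.

Lemma path_sum1 d x : path_sum d [:: x] = 0.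
Proof. by rewrite /path_sum big_nil. Qed.

Lemma path_sum0 d : path_sum d [::] = 0.
Proof. by rewrite /path_sum big_nil. Qed.

Lemma path_sum_le d1 d2 xs :
  (forall x y, x \in xs -> y \in xs -> d1 x y <= d2 x y) ->
  path_sum d1 xs <= path_sum d2 xs.
Proof.
case: xs => [|x xs]; first by rewrite !path_sum0.
elim: xs x => [|y xs IH] x H; first by rewrite !path_sum1.
rewrite !path_sum_cons lerD//; first by rewrite H ?inE ?eqxx ?orbT.
by apply: IH => p q pP qP; apply: H; rewrite inE ?pP ?qP orbT.
Qed.

Lemma path_sumD d1 d2 xs :
  path_sum (fun x y => d1 x y + d2 x y) xs = path_sum d1 xs + path_sum d2 xs.
Proof. exact: big_split. Qed.

Lemma path_sumZ c d xs : path_sum (fun x y => c * d x y) xs = c * path_sum d xs.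
Proof. by rewrite /path_sum mulr_sumr. Qed.

Lemma path_sum_sum n (d : 'I_n -> X -> X -> R) xs :
  path_sum (fun x y => \sum_(i < n) d i x y) xs = \sum_(i < n) path_sum (d i) xs.
Proof. exact: exchange_big. Qed.

Lemma path_sum_nth d x0 x xs : path_sum d (x :: xs) =
  \sum_(i < size xs) d (nth x0 (x :: xs) i) (nth x0 (x :: xs) i.+1).
Proof.
elim: xs x => [|y xs IH] x; first by rewrite path_sum1 big_ord0.
by rewrite path_sum_cons IH big_ord_recl.
Qed.

(** The extra [B] pays for the step across the junction. *)
Lemma path_sum_cat d B xs ys : 0 <= B -> (forall x y, d x y <= B) ->
  path_sum d (xs ++ ys) <= path_sum d xs + path_sum d ys + B.
Proof.
move=> B0 dB; case: xs => [|x xs]; first by rewrite path_sum0 add0r lerDl.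
elim: xs x => [|x' xs IH] x.
  case: ys => [|y ys]; first by rewrite !path_sum1 path_sum0 !add0r.
  by rewrite [_ ++ _]/= path_sum_cons path_sum1 add0r addrC lerD2l.
by rewrite !cat_cons !path_sum_cons -!addrA lerD2l addrA; exact: IH.
Qed.

Lemma increasing_disjoint x0 x xs : increasing (x :: xs) ->
  disjoint_intervals (fun i : 'I_(size xs) => nth x0 (x :: xs) i)
                     (fun i : 'I_(size xs) => nth x0 (x :: xs) i.+1).
Proof.
move=> xsI; pose t i := crd (nth x0 (x :: xs) i).
have tlt i j : (i < j)%N -> (j < (size xs).+1)%N -> t i < t j.
  move=> ij jn; have := sorted_ltn_nth lt_trans 0 xsI.
  move=> /(_ i j); rewrite !inE size_map /= => /(_ (ltn_trans ij jn) jn ij).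
  by rewrite -map_cons !(nth_map x0)//= (ltn_trans ij jn).
have tle i j : (i <= j)%N -> (j < (size xs).+1)%N -> t i <= t j.
  by rewrite leq_eqVlt => /predU1P[->//|ij jn]; exact/ltW/tlt.
split=> [i|i j ij bij]; first exact: (tlt i i.+1 (leqnn _) (ltn_ord i)).
have ji : (i < j)%N.
  rewrite ltn_neqAle ij leqNgt; apply/negP => ji.
  have : t j.+1 < t i.+1 by exact: (tlt j.+1 i.+1 ji (ltn_ord i)).
  by rewrite ltNge; move/negP; apply.
exact: (tle i.+1 j ji (ltnW (ltn_ord j))).
Qed.

Lemma path_sum_AC (s : scalars) (E : normedModType (scalar_field R s)) (f : X -> E)
    (eps : R) : abs_continuous f -> 0 < eps ->
  exists2 del : R, 0 < del & forall xs l u, increasing xs -> l <= u -> u - l < del ->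
    (forall x, x \in xs -> l <= crd x <= u) ->
    path_sum (fun x y => rnorm (f y - f x)) xs <= eps.
Proof.
move=> /abs_continuousE fAC eps0; have [d d0 fd] := fAC _ eps0.
exists d => // -[|x xs] l u xsI lu ul inxs; first by rewrite path_sum0 ltW.
rewrite (path_sum_nth _ x); have dxs := increasing_disjoint x xsI.
apply/ltW/fd => //.
have := @sum_increments_le _ _ _ _ _ id [set: 'I_(size xs)]%SET l u dxs.
move=> /(_ (fun _ _ h => h) lu) H; apply: le_lt_trans ul; move: H.
rewrite (eq_bigl xpredT) => [|i]; last by rewrite inE.
apply=> i _; split.
  have iS : (i < size (x :: xs))%N by exact: ltnW (ltn_ord i).
  by have /andP[] := inxs _ (mem_nth x iS).
have iS : (i.+1 < size (x :: xs))%N by exact: ltn_ord i.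
by have /andP[] := inxs _ (mem_nth x iS).
Qed.

(** The range of coordinates is cut into finitely many short cells. Each contributes at most 1, and
    each passage to the next cell at most [2 * M]. *)
Lemma abs_continuous_BV (s : scalars) (E : normedModType (scalar_field R s))
    (f : X -> E) : compact X -> abs_continuous f ->
  exists2 B : R, 0 < B & forall xs, increasing xs ->
    path_sum (fun x y => rnorm (f y - f x)) xs <= B.
Proof.
move=> cX fAC; have [B B0 XB] := compact_bounds cX.
have [M M0 fM] := abs_continuous_bounded cX fAC.
have [d d0 fd] := path_sum_AC fAC ltr01.
have fM2 x y : rnorm (f y - f x) <= 2 * M.
  apply: le_trans (rnormD _ _) _; rewrite rnormN.
  have := fM x; have := fM y; lra.
have M20 : 0 <= 2 * M by lra.
(* Cells of length [d / 2] satisfy the strict bound required of a window. *)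
have d2 : 0 < d / 2 by lra.
have grid N xs : increasing xs ->
    (forall x, x \in xs -> crd x < - B + N%:R * (d / 2)) ->
    path_sum (fun x y => rnorm (f y - f x)) xs <= N%:R * (2 * M + 1).
  elim: N xs => [|N IH] xs xsI inxs.
    case: xs xsI inxs => [|x xs] _ inxs; first by rewrite path_sum0 mul0r.
    have := inxs x (mem_head _ _); have := XB x; rewrite mul0r; lra.
  pose c := - B + N%:R * (d / 2).
  have le_tr : transitive (fun x y : X => crd x < crd y).
    by move=> y x z; exact: lt_trans.
  have xsI' : sorted (fun x y : X => crd x < crd y) xs by rewrite -sorted_map.
  have -> : xs = [seq x <- xs | crd x < c] ++ [seq x <- xs | ~~ (crd x < c)].
    elim: xs xsI' {xsI inxs} => //= x xs IHxs xP.
    have /andP[xall xsS] : all (fun y => crd x < crd y) xs &&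
        sorted (fun x y : X => crd x < crd y) xs.
      by rewrite -path_sortedE.
    case: ltP => xc /=; first by congr cons; exact: IHxs.
    have -> : [seq x <- xs | crd x < c] = [::].
      apply/eqP; rewrite -(negbK (_ == _)) -has_filter; apply/hasPn => y yxs.
      by rewrite -leNgt ltW// (le_lt_trans xc)// (allP xall).
    congr cons; apply/esym/all_filterP/allP => y yxs.
    by rewrite -leNgt ltW// (le_lt_trans xc)// (allP xall).
  apply: le_trans (path_sum_cat _ _ M20 fM2) _.
  have -> : N.+1%:R * (2 * M + 1) = N%:R * (2 * M + 1) + 1 + 2 * M.
    by rewrite -natr1; lra.
  rewrite lerD2r lerD//.
    apply: IH => [|x]; last by rewrite mem_filter => /andP[].
    by rewrite /increasing sorted_map; apply: sorted_filter.
  apply: (fd _ c (c + d / 2)); [|lra|lra|].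
    by rewrite /increasing sorted_map; apply: sorted_filter.
  move=> x; rewrite mem_filter -leNgt => /andP[-> /inxs] /=.
  by rewrite -natr1 mulrDl mul1r addrA => /ltW.
set N := (Num.truncn (2 * B / (d / 2))).+1.
exists (N%:R * (2 * M + 1)) => [|xs xsI]; first by rewrite mulr_gt0//; lra.
apply: grid => // x _; have := truncnS_gt (2 * B / (d / 2)).
rewrite -/N ltr_pdivrMr//; have := XB x; lra.
Qed.

(** [w] is a piecewise linear variation function: one ramp of height [d x y] for each pair of
    consecutive points. It is Lipschitz as the points are finitely many, and it dominates [d] by the
    triangle inequality. *)
Lemma discrete_variation d xs : increasing xs -> (forall x y, 0 <= d x y) ->
  (forall x y z, d x z <= d x y + d y z) ->
  exists (w : R -> R) (L : R), [/\ 0 <= L, {homo w : t u / t <= u},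
    forall t u, `|w t - w u| <= L * `|t - u|,
    forall t, 0 <= w t <= path_sum d xs &
    forall p q, p \in xs -> q \in xs -> crd p < crd q ->
      d p q <= w (crd q) - w (crd p)].
Proof.
move=> xsI d0 dtri; case: xs xsI => [|x xs].
  exists (fun _ => 0), 0; split=> //; first by move=> t u; rewrite subrr normr0 mul0r.
  by move=> t; rewrite path_sum0 lexx.
elim: xs x => [|y xs IH] x xsI.
  exists (fun _ => 0), 0; split=> //; first by move=> t u; rewrite subrr normr0 mul0r.
    by move=> t; rewrite path_sum1 lexx.
  by move=> p q; rewrite !inE => /eqP -> /eqP ->; rewrite ltxx.
have /andP[xy ysI] : (crd x < crd y) && increasing (y :: xs) by [].
have [w [L [L0 wh wL wB wd]]] := IH y ysI.
have xlt z : z \in y :: xs -> crd x < crd z.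
  have : path <%R (crd x) (map (@crd R X) (y :: xs)) by [].
  rewrite path_sortedE; last exact: lt_trans.
  move=> /andP[/allP H _] zP; apply: H; exact: map_f.
have yle z : z \in y :: xs -> crd y <= crd z.
  rewrite inE => /predU1P[->//|zP].
  have : path <%R (crd y) (map (@crd R X) xs) by [].
  rewrite path_sortedE; last exact: lt_trans.
  by move=> /andP[/allP H _]; apply/ltW/H/map_f.
pose r := ramp (crd x) (crd y).
have rh : {homo r : t u / t <= u} by exact: ramp_homo.
have yx0 : 0 <= (crd y - crd x)^-1 by rewrite invr_ge0 subr_ge0 ltW.
exists (fun t => d x y * r t + w t), (d x y * (crd y - crd x)^-1 + L); split.
- by rewrite addr_ge0// mulr_ge0.
- by move=> t u tu; rewrite lerD ?wh// ler_wpM2l// rh.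
- move=> t u.
  have -> : d x y * r t + w t - (d x y * r u + w u) =
            d x y * (r t - r u) + (w t - w u) by lra.
  apply: le_trans (ler_normD _ _) _; rewrite mulrDl lerD// normrM -mulrA.
  by rewrite (ger0_norm (d0 x y)) ler_wpM2l//; exact: ramp_lipschitz.
- move=> t; rewrite path_sum_cons; have /andP[r0 r1] := ramp_bounds (crd x) (crd y) t.
  have /andP[w0 w1] := wB t; rewrite addr_ge0 ?mulr_ge0//= lerD//.
  by rewrite ler_piMr.
move=> p q; rewrite 2!(in_cons x) => /predU1P[->|pP] /predU1P[->|qP]; rewrite ?ltxx//.
- move=> xq; have qy := yle q qP.
  have -> : r (crd q) = 1 by exact: ramp1.
  have -> : r (crd x) = 0 by exact: ramp0.
  have wxy := wh _ _ (ltW xy).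
  move: qy; rewrite le_eqVlt => /predU1P[/crd_inj <-|yq]; first lra.
  have := wd _ _ (mem_head _ _) qP yq; have := dtri x y q; lra.
- by move=> px; have := xlt p pP; lra.
- move=> pq; have := wd _ _ pP qP pq; have := rh _ _ (ltW pq).
  have := d0 x y; nra.
Qed.

Lemma increasing_cover (ys : seq X) :
  exists2 xs, increasing xs & forall y, y \in ys -> y \in xs.
Proof.
exists (sort (relpre (@crd R X) <=%R) (undup ys)).
  rewrite /increasing -sort_map sort_lt_sorted map_inj_uniq ?undup_uniq//.
by move=> y; rewrite mem_sort mem_undup.
Qed.
End PathSums.

(** * Variation of compositions with [h] *)

Section MonotoneSuperposition.
Context {R : realType} {s : scalars} {X Y : set R}.
Context {E : normedModType (scalar_field R s)}.
Variables (h : Y -> X) (v : E).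

Definition composed_variation (u : R -> R) (ys : seq Y) : R :=
  path_sum (fun y y' => `|u (crd (h y')) - u (crd (h y))|) ys.

(** To be obtained from [T]: the image of [u] times [v] has bounded variation, and its value at [y]
    is [u (h y)] times a vector bounded away from 0. *)
Hypothesis hBV : forall u : R -> R, {homo u : t t' / t <= t'} ->
  (forall t, 0 <= u t <= 1) ->
  abs_continuous (fun x : X => scalar_of s (u (crd x)) *: v) ->
  exists B, forall ys, increasing ys -> composed_variation u ys <= B.

(* Condensation of singularities: if [w k] has composed variation at least
   [4 ^ k], then the sum of the [2 ^- k.+1 * w k] has infinite one, because
   increments of nondecreasing functions cannot cancel each other. *)
Lemma composed_variation_uniform : exists2 C : R, 0 < C &
  forall (w : R -> R) (L : R), 0 <= L -> {homo w : t t' / t <= t'} ->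
    (forall t t', `|w t - w t'| <= L * `|t - t'|) ->
    (forall t, 0 <= w t <= 1) ->
    forall ys, increasing ys -> composed_variation w ys <= C.
Proof.
apply: contrapT => nC.
have /choice[w wP] k : exists w : R -> R, exists L ys,
    [/\ 0 <= L, {homo w : t t' / t <= t'},
        forall t t', `|w t - w t'| <= L * `|t - t'|,
        forall t, 0 <= w t <= 1 &
        increasing ys /\ 4 ^+ k < composed_variation w ys].
  apply: contrapT => nw; apply: nC; exists (4 ^+ k); first by rewrite exprn_gt0.
  move=> w L L0 wh wL wB ys ysI; rewrite leNgt; apply/negP => wk.
  by apply: nw; exists w, L, ys.
have wh k : {homo w k : t t' / t <= t'} by have [L [ys []]] := wP k.
have w0 k t : 0 <= w k t by have [L [ys [_ _ _ /(_ t)/andP[]]]] := wP k.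
have w1 k t : w k t <= 1 by have [L [ys [_ _ _ /(_ t)/andP[]]]] := wP k.
pose c k : R := 2^-1 ^+ k.+1.
have c0 k : 0 <= c k by rewrite exprn_ge0.
pose p N t := \sum_(0 <= k < N) c k * w k t.
have pM N M t : (N <= M)%N -> p M t = p N t + \sum_(N <= k < M) c k * w k t.
  by move=> NM; rewrite /p (big_cat_nat (leq0n _) NM).
have tail N M t : (N <= M)%N -> 0 <= \sum_(N <= k < M) c k * w k t <= 2^-1 ^+ N.
  move=> NM; rewrite sumr_ge0/= => [|k _]; last by rewrite mulr_ge0.
  apply: (@le_trans _ _ (\sum_(N <= k < M) 2^-1 * 2^-1 ^+ k)).
    by apply: ler_sum => k _; rewrite -exprS ler_piMr.
  rewrite -mulr_sumr; have := @half_expr_sum R _ _ NM.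
  have : 0 <= (2^-1 : R) ^+ M by rewrite exprn_ge0.
  lra.
have tailh N M t t' : t <= t' ->
    \sum_(N <= k < M) c k * w k t <= \sum_(N <= k < M) c k * w k t'.
  by move=> tt'; apply: ler_sum => k _; rewrite ler_wpM2l// wh.
pose A t := range (fun N => p N t).
have A0 t : A t (p 0%N t) by exists 0%N.
have p1 N t : p N t <= 1 by have /andP[] := tail 0%N N t (leq0n N); rewrite expr0.
have supA t : has_sup (A t).
  by split; [exists (p 0%N t)|exists 1 => _ [N _ <-]].
(* The sum of the series, as the supremum of its nondecreasing partial sums. *)
pose f t := sup (A t).
have pf N t : p N t <= f t by apply: sup_upper_bound => //; exists N.
have fle N t z : (forall M, (N <= M)%N -> p M t <= z) -> f t <= z.
  move=> pz; apply: sup_le_ub; first by exists (p 0%N t).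
  move=> _ [M _ <-]; have [/pz//|/ltnW MN] := leqP N M.
  apply: le_trans (pz N (leqnn _)); rewrite (pM M N)// lerDl.
  by have /andP[] := tail M N t MN.
have remh N : {homo (fun t => f t - p N t) : t t' / t <= t'}.
  move=> t t' tt'; rewrite lerBlDr; apply: (fle N) => M NM.
  have := pf M t'; rewrite !(pM N M)//; have := tailh N M _ _ tt'; lra.
have remB N t : 0 <= f t - p N t <= 2^-1 ^+ N.
  rewrite subr_ge0 pf /= lerBlDl; apply: (fle N) => M NM.
  by rewrite (pM N M)// lerD2l; have /andP[] := tail N M t NM.
have fh : {homo f : t t' / t <= t'}.
  by move=> t t' /(remh 0%N); rewrite /p !big_geq// !subr0.
have fB t : 0 <= f t <= 1 by have := remB 0%N t; rewrite /p big_geq// subr0 expr0.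
(* The partial sums are Lipschitz. The remainder is nondecreasing with values between 0 and
   [2 ^- N], which bounds its variation. *)
have fAC : abs_continuous (fun x : X => scalar_of s (f (crd x)) *: v).
  apply: abs_continuous_limit => eps eps0.
  have v1 : 0 < rnorm v + 1 by have := rnorm_ge0 v; lra.
  have [N Ne] := half_expr_small (divr_gt0 eps0 v1).
  exists (fun x => scalar_of s (p N (crd x)) *: v).
    have [L L0 pL] : exists2 L, 0 <= L &
        forall t t', `|p N t - p N t'| <= L * `|t - t'|.
      elim: N {Ne} => [|N [L L0 pL]].
        by exists 0 => // t t'; rewrite /p !big_geq// subrr normr0 mul0r.
      have [L' [ys [L'0 _ wL _ _]]] := wP N.
      exists (L + c N * L') => [|t t']; first by rewrite addr_ge0// mulr_ge0.
      rewrite /p !big_nat_recr//= -!/(p N _) opprD addrACA -mulrBr.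
      apply: le_trans (ler_normD _ _) _; rewrite mulrDl lerD// normrM.
      by rewrite (ger0_norm (c0 N)) -mulrA ler_wpM2l.
    apply: (@abs_continuous_lipschitz _ _ _ _ _ (L * rnorm v)) => [|x y].
      by rewrite mulr_ge0// rnorm_ge0.
    by rewrite -scalerBl -scalar_ofB rnorm_scale mulrAC ler_wpM2r ?rnorm_ge0.
  move=> m a b dab.
  have := sum_increments_bounded dab (remh N) (remB N) => rem.
  apply: (@le_trans _ _ (\sum_(i < m) (f (crd (b i)) - p N (crd (b i)) -
      (f (crd (a i)) - p N (crd (a i)))) * rnorm v)).
    apply: ler_sum => i _; rewrite -!scalerBl -!scalar_ofB rnorm_scale ger0_norm//.
    by rewrite subr_ge0 remh// ltW// dab.1.
  rewrite -mulr_suml; move: Ne; rewrite ltr_pdivlMr//.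
  have := rnorm_ge0 v; have : 0 <= (2^-1 : R) ^+ N by rewrite exprn_ge0.
  by nra.
have [B fBV] := hBV fh fB fAC.
have ck k : 2 ^+ k <= 2 * B.
  have [L [ys [_ _ _ _ [ysI wk]]]] := wP k.
  have cwf : c k * composed_variation (w k) ys <= composed_variation f ys.
    rewrite -path_sumZ; apply: path_sum_le => y y' _ _.
    (* The other terms and the remainder are nondecreasing, so they can only enlarge the increment
       of [c k * w k]. *)
    have cwfh t t' : t <= t' -> c k * (w k t' - w k t) <= f t' - f t.
      move=> tt'; have := remh k.+1 _ _ tt'; have := tailh 0%N k _ _ tt'.
      by rewrite /p !big_nat_recr//=; lra.
    have [yy'|/ltW y'y] := leP (crd (h y)) (crd (h y')).
      by rewrite !ger0_norm ?subr_ge0 ?wh ?fh//; exact: cwfh.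
    by rewrite distrC [leRHS]distrC !ger0_norm ?subr_ge0 ?wh ?fh//; exact: cwfh.
  have := fBV _ ysI; have : c k * 4 ^+ k <= c k * composed_variation (w k) ys.
    by apply: ler_wpM2l => //; exact: ltW.
  (* The threshold [4 ^ k] outgrows the weight [2 ^- k.+1], leaving a quantity unbounded in [k]. *)
  have -> : c k * 4 ^+ k = 2 ^+ k / 2.
    rewrite /c exprS (_ : 4 = 2 * 2 :> R) ?exprMn; last lra.
    by rewrite exprVn -mulrA mulKf ?expf_neq0// mulrC.
  lra.
have := ck (Num.truncn (2 * B)).+1; have := truncnS_gt (2 * B).
set k := _.+1 => kB; apply/negP; rewrite -ltNge; apply: (lt_trans kB).
by rewrite -natrX ltr_nat ltn_expl.
Qed.

(** The points [h y] are sorted in [X], and the increments of [f] between them are dominated by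
    those of a discrete variation function [w]. The uniform bound applies to [w / V], whatever order
    [h] visits the points in. *)
Lemma composed_variation_le : exists2 C : R, 0 < C &
  forall (F : normedModType (scalar_field R s)) (f : X -> F) (V : R), 0 < V ->
    (forall xs, increasing xs -> path_sum (fun x y => rnorm (f y - f x)) xs <= V) ->
    forall ys, increasing ys ->
      path_sum (fun y y' => rnorm (f (h y') - f (h y))) ys <= C * V.
Proof.
have [C C0 wC] := composed_variation_uniform; exists C => // F f V V0 fV ys ysI.
have [xs xsI xsP] := increasing_cover (map h ys).
have [||w [L [L0 wh wL wB wd]]] :=
  discrete_variation (d := fun x y => rnorm (f y - f x)) xsI.
- by move=> x y; exact: rnorm_ge0.
- by move=> x y z; rewrite [leRHS]addrC; exact: rdistrD.
have Vi0 : 0 <= V^-1 by rewrite invr_ge0 ltW.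
rewrite -ler_pdivrMr//; have := wC (fun t => V^-1 * w t) (V^-1 * L).
move=> /(_ _ _ _ _ ys ysI) H; apply: le_trans (H _ _ _ _).
- rewrite mulrC -path_sumZ; apply: path_sum_le => y y' yP y'P.
  rewrite -mulrBr normrM (ger0_norm Vi0) ler_wpM2l//.
  have yxs := xsP _ (map_f h yP); have y'xs := xsP _ (map_f h y'P).
  have [yy'|y'y|/crd_inj ->] := ltgtP (crd (h y)) (crd (h y')).
  + by apply: le_trans (wd _ _ yxs y'xs yy') _; exact: ler_norm.
  + by rewrite rdistrC distrC; apply: le_trans (wd _ _ y'xs yxs y'y) _; exact: ler_norm.
  + by rewrite !subrr rnorm0 normr0.
- by rewrite mulr_ge0.
- by move=> t t' tt'; rewrite ler_wpM2l// wh.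
- by move=> t t'; rewrite -mulrBr normrM (ger0_norm Vi0) -mulrA ler_wpM2l.
- move=> t; have /andP[wt0 wt1] := wB t; rewrite mulr_ge0//=.
  by rewrite mulrC ler_pdivrMr// mul1r (le_trans wt1)// fV.
Qed.
End MonotoneSuperposition.

(** * Real bounds for the extended-real norm *)

Section Norm.
Context {R : realType} {s : scalars} {X : set R}.
Context {E : normedModType (scalar_field R s)}.

Lemma AC_norm_lt (f : AC_space X E) (d : R) : (AC_norm f < d%:E)%E ->
  (forall x, rnorm (f x) <= d) /\
  (forall xs, increasing xs -> path_sum (fun x y => rnorm (f y - f x)) xs <= d).
Proof.
move=> fd.
(* Both summands are nonnegative, thanks to the added point 0 and the empty list, so each is at most
   their sum. *)
have s0 : (0 <= sup_norm f)%E by apply: ereal_sup_ubound; left.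
have v0 : (0 <= Defs.variation f)%E.
  by apply: ereal_sup_ubound; exists [::] => //; rewrite big_nil.
split=> [x|xs xsI]; rewrite -lee_fin; apply: le_trans (ltW fd).
  apply: (@le_trans _ _ (sup_norm f)); last by rewrite leeDl.
  by apply: ereal_sup_ubound; right; exists x.
apply: (@le_trans _ _ (Defs.variation f)); last by rewrite leeDr.
by apply: ereal_sup_ubound; exists xs.
Qed.

Lemma AC_norm_le (f : AC_space X E) (a b : R) : 0 <= a ->
  (forall x, rnorm (f x) <= a) ->
  (forall xs, increasing xs -> path_sum (fun x y => rnorm (f y - f x)) xs <= b) ->
  (AC_norm f <= (a + b)%:E)%E.
Proof.
move=> a0 fa fb; rewrite EFinD; apply: leeD; apply: ge_ereal_sup.
  by move=> _ [->|[x _ <-]]; rewrite lee_fin.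
by move=> _ [xs xsI <-]; rewrite lee_fin; exact: fb.
Qed.
End Norm.

(** * Weighted composition operators *)

Section WeightedComposition.
Context {R : realType} {s : scalars}.
Implicit Types X Y : set R.
Local Notation K := (scalar_field R s).
Implicit Types E F : normedModType K.

Definition pointwise_separating X Y E F (T : AC_space X E -> AC_space Y F) :=
  forall f g : AC_space X E, (forall x, f x = 0 \/ g x = 0) ->
    forall y, T f y = 0 \/ T g y = 0.

Lemma cozero_disjoint X E (f g : AC_space X E) :
  cozero f `&` cozero g = set0 <-> forall x, f x = 0 \/ g x = 0.
Proof.
split=> [fg x|fg]; last first.
  by rewrite -subset0 => x [/= /eqP fx /eqP gx]; case: (fg x).
have [->|fx] := eqVneq (f x) 0; first by left.
have [->|gx] := eqVneq (g x) 0; first by right.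
by have : (cozero f `&` cozero g) x by []; rewrite fg.
Qed.

Lemma separatingP X Y E F (T : AC_space X E -> AC_space Y F) :
  separating T <-> linear T /\ pointwise_separating T.
Proof.
by split=> -[Tl Ts]; split=> // f g fg; apply/cozero_disjoint/Ts/cozero_disjoint.
Qed.

(** The weight at [y] is read off from the constant functions as [fun v => T (AC_cst v) y]. *)
Definition weighted_composition X Y E F (T : AC_space X E -> AC_space Y F)
    (h : Y -> X) :=
  (forall f y, T f y = T (AC_cst (f (h y))) y) /\
  (forall v y, T (AC_cst v) y = 0 -> v = 0).

(** Without discontinuities [T f y] depends on [f (h y)] alone. Each weight is surjective since [T]
    is, hence injective by equality of dimensions. *)
Lemma weighted_composition_ex X Y E F n (T : {linear AC_space X E -> AC_space Y F}) :
  compact X -> compact Y -> (0 < n)%N -> Vector.axiom n E -> Vector.axiom n F ->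
  pointwise_separating T -> (forall f, T f = 0 -> f = 0) ->
  (forall g, exists f, T f = g) ->
  exists2 h : Y -> X, weighted_composition T h &
    forall (x : X) (r : R), 0 < r -> exists y, `|crd (h y) - crd x| < r.
Proof.
move=> cX cY n0 dE dF sepT Ti Ts.
have Tsurj y w : exists f, T f y = w.
  have [g gE] := AC_space_of (@abs_continuous_cst R s Y F w).
  by have [f Tf] := Ts g; exists f; rewrite Tf gE.
(* The term exhibits some [f] whose image at [y] is a given nonzero vector, as support points
   require. *)
have /choice[h hT] y := support_point cX sepT
  (let: ex_intro w w0 := nonzero_vector n0 dF in
   let: ex_intro f fw := Tsurj y w in
   ex_intro (fun f => T f y != 0) f (eq_ind_r (fun u => u != 0) w0 fw)).
have hcst f y : T f y = T (AC_cst (f (h y))) y.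
  exact: continuity_point (no_discontinuity cX cY Ti Ts n0 dE dF hT (y := y)) f.
exists h; last exact: (support_dense cX Ti n0 dE hT).
split=> // v y.
have JL : linear (fun v => T (AC_cst v) y).
  by move=> a u u'; rewrite AC_cst_linear linearP AC_addE AC_scaleE.
have [J JE] := linear_ex JL.
have Js w : exists v, J v = w.
  by have [f fw] := Tsurj y w; exists (f (h y)); rewrite JE -hcst.
by move=> Jv; apply: (surjective_injective dE dF Js); rewrite JE.
Qed.

(** A bump at [x] of radius the distance to [x'] vanishes at [x'] and not at [x]. *)
Lemma AC_separates_points X E (v : E) (x x' : X) : compact X -> v != 0 ->
  (forall f : AC_space X E, f x' = 0 -> f x = 0) -> x' = x.
Proof.
move=> cX v0 fx; apply/crd_inj/eqP/negPn/negP => xx'.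
have r0 : 0 < `|crd x' - crd x| by rewrite normr_gt0 subr_eq0.
have [g gE] := AC_cutoff (AC_cst v) (crd x) cX r0.
have : g x = 0 by apply: fx; rewrite gE bump0// scalar_of0 scale0r.
rewrite gE bump1//; last by rewrite subrr normr0; lra.
by rewrite scalar_of1 scale1r => /eqP; apply/negP.
Qed.

Lemma continuous_crd X : continuous (@crd R X).
Proof. exact: initial_continuous. Qed.

(** Take a bump [f] of radius [eps] at [h y]. Its image is nonzero near [y], but it is zero at every
    [z] with [h z] at distance at least [eps] from [h y]. *)
Lemma weighted_composition_continuous X Y E F
    (T : {linear AC_space X E -> AC_space Y F}) (h : Y -> X) (v : E) :
  compact X -> v != 0 -> weighted_composition T h -> continuous h.
Proof.
move=> cX v0 [hT Tv]; apply/continuous_comp_initial => y.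
apply/(@cvgrPdist_lt _ _ _ _ (nbhs_filter y)) => eps eps0.
have [f fE] := AC_cutoff (AC_cst v) (crd (h y)) cX eps0.
have fhy : f (h y) = v.
  by rewrite fE bump1 ?scalar_of1 ?scale1r// subrr normr0; lra.
have Tfy : 0 < rnorm (T f y).
  by rewrite rnorm_gt0 hT fhy; apply: contra_neq v0; exact: Tv.
have [d d0 Tfd] := abs_continuous_uniform (AC_funP (T f)) Tfy.
have : \forall z \near y, `|crd z - crd y| < d.
  have /(@cvgrPdist_lt _ _ _ _ (nbhs_filter y))/(_ _ d0) := @continuous_crd Y y.
  by apply: filterS => z; rewrite distrC.
apply: filterS => z /Tfd zy; rewrite -/(crd _) distrC ltNge; apply/negP => hz.
have Tfz : T f z = 0.
  rewrite hT fE bump0// scalar_of0 scale0r.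
  have [c cE] := linear_ex (@AC_cst_linear R s X E).
  by rewrite -cE !linear0.
by move: zy; rewrite Tfz sub0r rnormN ltxx.
Qed.

Lemma bounded_continuous E F (J : {linear E -> F}) (M : R) : 0 < M ->
  (forall v, rnorm (J v) <= M * rnorm v) -> continuous J.
Proof.
move=> M0 JM v; apply/cvgrPdist_lt => eps eps0.
(* Here [eps] is a positive element of the scalar field, hence real. *)
have epsE := scalar_reK (ltW eps0).
have re0 : 0 < scalar_re eps by rewrite -(scalar_of_lt s) epsE scalar_of0.
apply/nbhs_normP; exists (scalar_of s (scalar_re eps / M)) => [|u /=].
  by rewrite /= -(scalar_of0 _ s) scalar_of_lt divr_gt0.
rewrite !rnormE scalar_of_lt ltr_pdivlMr// => vu.
rewrite -epsE scalar_of_lt -linearB; apply: le_lt_trans (JM _) _.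
by rewrite mulrC.
Qed.

(** The product rule splits the variation of [T D] into that of [D] composed with [h] and that of
    the weights. The lower bound [m] on the weights gives control of the first. *)
Lemma weighted_composition_AC_continuous X Y E F n
    (T : {linear AC_space X E -> AC_space Y F}) (h : Y -> X) (v0 : E) (m : R) :
  compact X -> compact Y -> Vector.axiom n E -> v0 != 0 ->
  weighted_composition T h -> 0 < m ->
  (forall v y, rnorm v <= m * rnorm (T (AC_cst v) y)) -> AC_norm_continuous T.
Proof.
move=> cX cY dE v0n [hT _] m0 Tm.
have nv0 : 0 < rnorm v0 by rewrite rnorm_gt0.
have [M M0 TM] := eval_cst_bounded cY T dE.
have [c cE] := linear_ex (@AC_cst_linear R s X E).
pose A v := T (AC_cst v).
have AZ a v y : A (a *: v) y = a *: A v y by rewrite /A -cE !linearZ.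
have AB u v y : A (u - v) y = A u y - A v y by rewrite /A -cE !linearB.
have /choice[B BP] v : exists B, 0 < B /\ forall ys, increasing ys ->
    path_sum (fun y z => rnorm (A v z - A v y)) ys <= B.
  by have [B B0 BP] := abs_continuous_BV cY (AC_funP (A v)); exists B.
have [C C0 hC] : exists2 C : R, 0 < C &
  forall (G : normedModType K) (f : X -> G) (V : R), 0 < V ->
    (forall xs, increasing xs -> path_sum (fun x y => rnorm (f y - f x)) xs <= V) ->
    forall ys, increasing ys ->
      path_sum (fun y y' => rnorm (f (h y') - f (h y))) ys <= C * V.
  (* An increment of [u] composed with [h], times [A v0 z], is the increment of [T g] minus
     [u (h y)] times that of [A v0]; both have bounded variation. *)
  apply: (@composed_variation_le _ _ _ _ _ h v0) => u uh uB uAC.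
  have [g gE] := AC_space_of uAC.
  have [B' B'0 B'P] := abs_continuous_BV cY (AC_funP (T g)).
  exists ((m / rnorm v0) * (B' + B v0)) => ys ysI.
  apply: (@le_trans _ _ (path_sum (fun y z => m / rnorm v0 *
      (rnorm (T g z - T g y) + rnorm (A v0 z - A v0 y))) ys)); last first.
    rewrite path_sumZ path_sumD ler_wpM2l ?divr_ge0 ?(ltW m0) ?(ltW nv0)//.
    by rewrite lerD ?B'P//; have [_] := BP v0; exact.
  apply: path_sum_le => y z _ _; rewrite mulrAC ler_pdivlMr//.
  have Tg z' : T g z' = scalar_of s (u (crd (h z'))) *: A v0 z'.
    by rewrite hT gE -/(A _) AZ.
  apply: (@le_trans _ _ (`|u (crd (h z)) - u (crd (h y))| * (m * rnorm (A v0 z)))).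
    by rewrite ler_wpM2l// Tm.
  rewrite mulrCA ler_wpM2l ?(ltW m0)// -rnorm_scale scalar_ofB scalerBl -Tg.
  apply: le_trans (rdistrD (T g y) _ _) _; rewrite lerD2l Tg -scalerBr rnorm_scale.
  have /andP[u0 u1] := uB (crd (h y)).
  by rewrite ger0_norm// rdistrC ler_piMl// rnorm_ge0.
have [e [co [vE [C' C'0 coC]]]] := finite_dim_basis dE.
(* [W] collects the supremum bound, the variation of [D] composed with [h], and that of the weights,
   per unit of [d]; the choice of [d] gives [d * W = eps / 2]. *)
pose W := M + (M * C + C' * \sum_(i < n) B (e i)).
have BS : 0 <= \sum_(i < n) B (e i) by apply: sumr_ge0 => i _; exact: ltW (BP _).1.
have W0 : 0 < W by rewrite ltr_pwDl// addr_ge0// mulr_ge0// ltW.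
move=> f eps eps0; exists (eps / (2 * W)) => [|g]; first by rewrite divr_gt0// mulr_gt0.
set d := eps / _ => /AC_norm_lt; set D := g - f => -[Dd DV].
have d0 : 0 < d by rewrite divr_gt0// mulr_gt0.
have -> : T g - T f = T D by rewrite linearB.
pose V := M * d + (M * (C * d) + C' * d * \sum_(i < n) B (e i)).
apply: (@le_lt_trans _ _ V%:E); last first.
  have -> : V = d * W by rewrite /V; rewrite /W; lra.
  rewrite lte_fin /d invfM mulrA mulfVK ?gt_eqF//; lra.
apply: AC_norm_le => [|y|ys ysI]; first by rewrite mulr_ge0// ltW.
  by rewrite hT; apply: le_trans (TM _ _) _; rewrite ler_wpM2l// ltW.
apply: (@le_trans _ _ (path_sum (fun y z => M * rnorm (D (h z) - D (h y)) +
    \sum_(i < n) C' * d * rnorm (A (e i) z - A (e i) y)) ys)).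
  apply: path_sum_le => y z _ _; rewrite !(hT D) -!/(A _).
  apply: le_trans (rdistrD (A (D (h y)) z) _ _) _; rewrite -AB lerD//; first exact: TM.
  have AS z' : A (D (h y)) z' = \sum_(i < n) co (D (h y)) i *: A (e i) z'.
    rewrite {1}(vE (D (h y))) /A -cE !linear_sum AC_sumE; apply: eq_bigr => i _.
    by rewrite !linearZ.
  rewrite !AS -sumrB; apply: le_trans (rnorm_sum _ _ _) _; apply: ler_sum => i _.
  rewrite -scalerBr rnormZ ler_wpM2r ?rnorm_ge0//.
  by apply: le_trans (coC _ _) _; rewrite ler_wpM2l// ltW.
rewrite path_sumD path_sumZ path_sum_sum lerD//.
  by rewrite ler_wpM2l ?(ltW M0)//; apply: hC.
rewrite mulr_sumr; apply: ler_sum => i _.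
rewrite path_sumZ; apply: ler_wpM2l; first by apply: mulr_ge0; exact: ltW.
by have [_] := BP (e i); apply.
Qed.
End WeightedComposition.

(** * Symmetry between [T] and its inverse *)

Theorem theorem3p6 (R : realType) (s : scalars) (X Y : set R)
    (cptX : compact X) (cptY : compact Y) (n : nat) (n_ge1 : (1 <= n)%N)
    (E F : normedModType (scalar_field R s))
    (dimE : Vector.axiom n E) (dimF : Vector.axiom n F)
    (T : AC_space X E -> AC_space Y F) (sepT : separating T) (bijT : bijective T) :
  (exists (h : Y -> X) (J : Y -> E -> F),
      [/\ homeomorphism h,
          forall y : Y, [/\ linear (J y), bijective (J y) & continuous (J y)]
        & forall (f : AC_space X E) (y : Y), T f y = J y (f (h y))]) /\
  AC_norm_continuous T /\ biseparating T.
Proof.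
have [TL Tsep] := (separatingP T).1 sepT.
have [T' TE] := linear_ex TL; rewrite -{}TE {TL} in sepT bijT Tsep *.
move: T' => {}T in sepT bijT Tsep *.
have [S TS ST] := bijT.
have SL : linear S by move=> a u v; apply: (can_inj TS); rewrite linearP !ST.
have Ti f : T f = 0 -> f = 0 by move=> Tf; rewrite -(TS f) Tf -(linear0 T) TS.
have [h hT hdense] := weighted_composition_ex cptX cptY n_ge1 dimE dimF Tsep Ti
  (fun g => ex_intro _ (S g) (ST g)).
have [v v0] := nonzero_vector n_ge1 dimE; have [w w0] := nonzero_vector n_ge1 dimF.
have [S' SE] := linear_ex SL; rewrite -{}SE {S SL} in TS ST *.
move: S' => S in TS ST *.
(* If [S f] and [S g] were both nonzero at [x], they would be so at some nearby [h y] by density;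
   but [f y = 0] or [g y = 0] makes one of them vanish there. *)
have Ssep : pointwise_separating S.
  move=> f g fg x; have [->|fx] := eqVneq (S f x) 0; first by left.
  have [->|gx] := eqVneq (S g x) 0; first by right.
  exfalso; rewrite -rnorm_gt0 in fx; rewrite -rnorm_gt0 in gx.
  have [d d0 fd] := abs_continuous_uniform (AC_funP (S f)) fx.
  have [d' d'0 gd] := abs_continuous_uniform (AC_funP (S g)) gx.
  have [|y] := hdense x (Num.min d d'); first by rewrite lt_min d0.
  rewrite lt_min => /andP[/fd fy /gd gy].
  have nz (u : AC_space X E) : T u y = 0 -> u (h y) = 0 by rewrite hT.1 => /hT.2.
  case: (fg y) => [fy0|gy0].
    by move: fy; rewrite nz ?ST// sub0r rnormN ltxx.
  by move: gy; rewrite nz ?ST// sub0r rnormN ltxx.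
have Si g : S g = 0 -> g = 0 by move=> Sg; rewrite -(ST g) Sg linear0.
have [k kS _] := weighted_composition_ex cptY cptX n_ge1 dimF dimE Ssep Si
  (fun f => ex_intro _ (T f) (TS f)).
have T0 y : T (AC_cst 0) y = 0.
  by have [c cE] := linear_ex (@AC_cst_linear R s X E); rewrite -cE !linear0.
have S0 x : S (AC_cst 0) x = 0.
  by have [c cE] := linear_ex (@AC_cst_linear R s Y F); rewrite -cE !linear0.
(* The value [f x = S (T f) x] depends on [T f (k x)] alone, hence on [f (h (k x))] alone; functions
   separate points. *)
have hk x : h (k x) = x.
  apply: (AC_separates_points cptX v0) => f fx.
  by rewrite -(TS f) kS.1 hT.1 fx T0 S0.
have kh y : k (h y) = y.
  apply: (AC_separates_points cptY w0) => g gy.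
  by rewrite -(ST g) hT.1 kS.1 gy S0 T0.
have JL y : linear (fun u => T (AC_cst u) y).
  by move=> a u u'; rewrite AC_cst_linear linearP AC_addE AC_scaleE.
split; last split.
- exists h, (fun y u => T (AC_cst u) y); split; last exact: hT.1.
    exists k; split=> //.
      exact: weighted_composition_continuous cptX v0 hT.
    exact: weighted_composition_continuous cptY w0 kS.
  move=> y; split=> //.
    (* The weight of [S] at [h y] inverts that of [T] at [y], because [k (h y) = y]. *)
    exists (fun u => S (AC_cst u) (h y)) => u.
      have := kS.1 (T (AC_cst u)) (h y); rewrite kh TS; exact: esym.
    by rewrite -hT.1 ST.
  have [M M0 TM] := eval_cst_bounded cptY T dimE.
  have [J JE] := linear_ex (JL y); rewrite -JE.
  by apply: (bounded_continuous M0) => u; rewrite JE.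
(* The uniform bound on the weights of [S] is the lower bound on those of [T]. *)
- have [m m0 Sm] := eval_cst_bounded cptX S dimF.
  apply: (weighted_composition_AC_continuous cptX cptY dimE v0 hT m0) => u y.
  have := kS.1 (T (AC_cst u)) (h y); rewrite kh TS => uE.
  rewrite [in X in X <= _](_ : u = AC_cst u (h y))// uE; exact: Sm.
- exists S; split=> //; apply/separatingP; split=> // a u u'; exact: linearP.
Qed.
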